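(* For $\delta>-1$, let $\Delta_\phi$ be the friendship bias of the root $\phi$ of the Pólya point tree with parameters $m=1$ and $\delta$ (the local limit of the preferential attachment model with one edge per new vertex and shift parameter $\delta$), and let $d_1$ be the number of children of the root's first child $\phi_1$ (its child with label $\mathsf o$). Then for every $\delta>-1$, $$\mathbb P\{\Delta_\phi\ge x\}\asymp\mathbb P\{d_1\ge x\},\qquad x\to\infty.$$ In particular, $$\mathbb P\{\Delta_\phi\ge x\}\asymp x^{-(\tau-2)},\qquad x\to\infty,$$ with $\tau=\tau(\delta)=3+\delta$.
   Context: Pólya point tree ($m=1$, $\delta>-1$): a multi-type branching process tree with root $\phi$ in which each vertex $u$ has an age $A_u\in[0,1]$, and each non-root vertex also has a label $L_u\in\{\mathsf y,\mathsf o\}$ (''younger'' or ''older'' than its parent). The root's age $A_\phi$ is uniform on $[0,1]$ and the root has no label. Recursively, given a vertex $u$ with its age (and label): (1) If $u=\phi$ or $L_u=\mathsf o$, then $u$ has exactly one child with label $\mathsf o$, denoted $u1$, with age $A_{u1}=U_{u1}^{(2+\delta)/(1+\delta)}A_u$, where $U_{u1}$ is uniform on $[0,1]$, independent of everything else. If $L_u=\mathsf y$, then $u$ has no child with label $\mathsf o$. (2) The ages of the children of $u$ with label $\mathsf y$ are the (ordered) points of a Poisson point process on $[A_u,1]$ with intensity $\rho_u(x)=\frac{\Gamma_u}{2+\delta}\,\frac{x^{-(1+\delta)/(2+\delta)}}{A_u^{1/(2+\delta)}}$, where $\Gamma_u$ is chosen independently of everything else, with $\Gamma_u\sim\mathrm{Gamma}(1+\delta,1)$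 if $u$ is the root or $L_u=\mathsf y$, and $\Gamma_u\sim\mathrm{Gamma}(2+\delta,1)$ if $L_u=\mathsf o$. These children are enumerated after the $\mathsf o$-child (if any). Let $d_\phi\ge1$ be the number of children of the root, and $d_j$ the number of children of the $j$-th child $\phi_j$ of the root ($\phi_1$ is the $\mathsf o$-child, $\phi_2,\ldots,\phi_{d_\phi}$ the $\mathsf y$-children). The friendship bias of the root is $\Delta_\phi=\frac1{d_\phi}\sum_{j=1}^{d_\phi}(d_j+1)-d_\phi$. Notation: $a_x\asymp b_x$ as $x\to\infty$ means $0<\liminf_{x\to\infty}a_x/b_x\le\limsup_{x\to\infty}a_x/b_x<\infty$. *)

(* Defs.v *)
From HB Require Import structures.
From mathcomp Require Import all_boot all_order all_algebra.
From mathcomp Require Import all_classical all_reals all_analysis.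
Set Implicit Arguments.
Unset Strict Implicit.
Unset Printing Implicit Defensive.
Import Order.TTheory GRing.Theory Num.Theory.
Import numFieldNormedType.Exports.

Local Open Scope classical_set_scope.
Local Open Scope ring_scope.

(** ** Gamma(a, 1) distribution *)

Definition gamma_fun (R : realType) (a : R) : R :=
  \int[lebesgue_measure]_(x in `]0, +oo[) (x `^ (a - 1) * expR (- x)).

Definition gamma_pdf (R : realType) (a x : R) : R :=
  if 0 < x then x `^ (a - 1) * expR (- x) / gamma_fun a else 0.

Definition gamma_prob (R : realType) (a : R) (B : set R) : \bar R :=
  (\int[lebesgue_measure]_(x in B) (gamma_pdf a x)%:E)%E.

(** ** Independence and conditionally Poisson processes *)

Section Probability.
Context (d : measure_display) (Omega : measurableType d) (R : realType).
Variable P : probability Omega R.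

Definition mutually_independent (I : eqType) (X : I -> {RV P >-> R}) : Prop :=
  forall (s : seq I) (B : I -> set R), uniq s ->
    (forall i, measurable (B i)) ->
    P [set w | forall i, i \in s -> B i (X i w)] =
    (\prod_(i <- s) P (X i @^-1` B i))%E.

(* A finite point process is a random list of points. *)
Definition npoints (xi : Omega -> seq R) (B : set R) (w : Omega) : nat :=
  count (fun x => x \in B) (xi w).

(* On the event E, and conditionally on the sigma-algebra G, xi is a Poisson
   point process with mean measure mean w (finite, G-measurable in w).
   The library's poisson_prob takes an unused nat argument, set to 0 here.  It
   is the Dirac mass at 0 when the rate is 0, whereas poisson_pmf is not. *)
Definition cond_poisson_process (G : set (set Omega)) (E : set Omega)
    (xi : Omega -> seq R) (mean : Omega -> set R -> R) : Prop :=
  forall (F : set Omega) (m : nat) (B : 'I_m -> set R) (n : 'I_m -> nat),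
    G F -> (forall i, measurable (B i)) -> trivIset setT B ->
    P (F `&` E `&` [set w | forall i, npoints xi (B i) w = n i]) =
    (\int[P]_(w in F `&` E)
       \prod_(i < m) poisson_prob (mean w (B i)) 0%N [set n i])%E.

End Probability.

(** ** The Polya point tree *)

Variant vlabel := Younger | Older.

(* A vertex is the list of child indices leading to it from the root, the last
   index first: the k-th child of u is k :: u, and the root is [::].  Children
   are indexed from 0.  Since the older child, if any, is always the first one,
   labels are determined by the vertex. *)
Definition vertex := seq nat.

Definition has_older_child (l : option vlabel) : bool :=
  if l is Some Younger then false else true.

Fixpoint label (u : vertex) : option vlabel :=
  if u is k :: v then
    Some (if (k == 0)%N && has_older_child (label v) then Older else Younger)
  else None.

(* ppt_U [::] is the age of the root; for u != [::], ppt_U u is the variable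
   U_u, which is used only if u has label Older.  ppt_younger u lists the ages
   of the children of u that have label Younger. *)
Record ppt_data (d : measure_display) (Omega : measurableType d)
    (R : realType) (P : probability Omega R) := PPTData {
  ppt_U : vertex -> {RV P >-> R} ;
  ppt_Gamma : vertex -> {RV P >-> R} ;
  ppt_younger : vertex -> Omega -> seq R }.

Section PolyaPointTree.
Context (d : measure_display) (Omega : measurableType d) (R : realType).
Context (P : probability Omega R).
Variables (delta : R) (T : ppt_data P).

Fixpoint age (u : vertex) (w : Omega) : R :=
  match u with
  | [::] => ppt_U T [::] w
  | k :: v =>
      if label (k :: v) is Some Older then
        ppt_U T (k :: v) w `^ ((2 + delta) / (1 + delta)) * age v w
      else nth 0 (ppt_younger T v w) (k - has_older_child (label v))
  end.

Definition nchildren (u : vertex) (w : Omega) : nat :=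
  (has_older_child (label u) + size (ppt_younger T u w))%N.

Fixpoint in_tree (u : vertex) (w : Omega) : bool :=
  if u is k :: v then in_tree v w && (k < nchildren v w)%N else true.

Definition intensity (u : vertex) (w : Omega) (x : R) : R :=
  ppt_Gamma T u w / (2 + delta) *
  (x `^ (- ((1 + delta) / (2 + delta))) / age u w `^ (1 / (2 + delta))).

Definition mean_younger (u : vertex) (w : Omega) (B : set R) : R :=
  \int[lebesgue_measure]_(x in B `&` `[age u w, 1]) intensity u w x.

Definition gamma_shape (u : vertex) : R :=
  if label u is Some Older then 2 + delta else 1 + delta.

Definition noise (i : vertex + vertex) : {RV P >-> R} :=
  match i with inl u => ppt_U T u | inr u => ppt_Gamma T u end.

(* All variables U and Gamma, and the Younger children of all the vertices
   other than u and its descendants. *)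
Definition sigma_outside (u : vertex) : set (set Omega) :=
  <<s [set A | (exists i B, measurable B /\ A = noise i @^-1` B) \/
               (exists v B n, [/\ ~~ suffix u v, measurable B &
                  A = [set w | npoints (ppt_younger T v) B w = n]])] >>.

Record is_polya_point_tree : Prop := {
  ppt_indep : mutually_independent noise ;
  ppt_U_law : forall (u : vertex) (B : set R), measurable B ->
    distribution P (ppt_U T u) B = uniform_prob (@ltr01 R) B ;
  ppt_Gamma_law : forall (u : vertex) (B : set R), measurable B ->
    distribution P (ppt_Gamma T u) B = gamma_prob (gamma_shape u) B ;
  ppt_younger_measurable : forall (u : vertex) (B : set R), measurable B ->
    measurable_fun setT (npoints (ppt_younger T u) B) ;
  ppt_younger_sorted : forall (u : vertex) (w : Omega),
    sorted <=%R (ppt_younger T u w) ;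
  (* convention for words that are not vertices of the tree *)
  ppt_younger_outside : forall (u : vertex) (w : Omega),
    ~~ in_tree u w -> ppt_younger T u w = [::] ;
  ppt_younger_poisson : forall u : vertex,
    cond_poisson_process P (sigma_outside u) [set w | in_tree u w]
      (ppt_younger T u) (mean_younger u) }.

Definition friendship_bias (w : Omega) : R :=
  (\sum_(j < nchildren [::] w) (nchildren [:: nat_of_ord j] w + 1)%:R)
    / (nchildren [::] w)%:R - (nchildren [::] w)%:R.

End PolyaPointTree.

Definition tail_prob (d : measure_display) (Omega : measurableType d)
    (R : realType) (P : probability Omega R) (X : Omega -> R) (x : R) : R :=
  fine (P [set w | x <= X w]).

Definition asymp_pinfty (R : realType) (a b : R -> R) : Prop :=
  (0 < limf_einf (fun x => (a x / b x)%:E) +oo%R <=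
       limf_esup (fun x => (a x / b x)%:E) +oo%R)%E /\
  (limf_esup (fun x => (a x / b x)%:E) +oo%R < +oo)%E.

Definition tau (R : realType) (delta : R) : R := 3 + delta.

(* Main.v *)
(** Write a = 1 + delta and s = 2 + delta.  Given its age A and its Gamma
    variable G, a vertex has a Poisson number of Younger children of mean
    G * (A^(-1/s) - 1).  The older child of the root has age W^(s/a) * V with V
    and W uniform, so its mean is about G * W^(-1/a) * V^(-1/s).  Here W^(-1/a)
    has tail x^(-a), while G^a and V^(-a/s) are integrable, and this heavy factor
    determines the order x^(-a) of the tail of d_1.

    Upper bound: the bias is an average minus d_phi >= 1, so a bias of at least x
    forces some child of the root to have about x children.  The union bound over
    the Younger children of the root costs a factor equal to their mean number,
    of order V^(-1/s); as they are younger than the root, each of them has at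
    least y children with probability at most about min(1, (V^(-1/s) / y)^p), and
    E[V^(-1/s) * min(1, (V^(-1/s) / y)^p)] is again of order y^(-a).

    Lower bound: with probability bounded below the older child is the only child
    of the root, even given that W is small, and the bias is then exactly d_1. *)

(* The younger children of [u] are known only through conditional Poisson counts given
   [sigma_outside u]. So each event is first restricted to one of that sigma-algebra, the count at
   [u] is replaced by a Poisson probability, and what remains is an integral over independent noise
   variables. For a younger child this is done twice, at the child and then at the root.

   The minimum with 1 has to be kept in min(1, (2M/y)^p): since p > a, the p-th power of the heavy
   factor W^(-1/a) is not integrable. Integrating the truncated power over the uniform variable
   behind the heavy factor gives the exact order. It requires b + r > 1, with b = 0, r = p/a for the
   older child and b = 1/s, r = p/s for the younger ones; both conditions say p > a. The exponent p
   is an integer because the Poisson tail is bounded by a factorial moment.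

   That younger children are born after the root is only an almost sure consequence of the intensity
   being carried by [A, 1], and has to be proved from the counts. *)
Require Import Defs.
From HB Require Import structures.
From mathcomp Require Import all_boot all_order all_algebra.
From mathcomp Require Import all_classical all_reals all_analysis.
From mathcomp Require Import measurable_realfun ring lra.
Set Implicit Arguments.
Unset Strict Implicit.
Unset Printing Implicit Defensive.
Import Order.TTheory GRing.Theory Num.Theory.
Import numFieldNormedType.Exports.
Local Open Scope classical_set_scope.
Local Open Scope ring_scope.

(** * Integrals of powers *)

Section PowerIntegrals.
Context {R : realType}.
Notation mu := (@lebesgue_measure R).
Implicit Types b c r t x : R.

Lemma measurable_powR_EFin r (D : set R) :
  measurable_fun D (fun x : R => (x `^ r)%:E).
Proof.
by apply/measurable_EFinP; exact: measurable_funTS (measurable_powR r).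
Qed.

Lemma integral_powR r c t : 0 < c -> c <= t -> r != -1 ->
  (\int[mu]_(x in `[c, t]) (x `^ r)%:E =
   ((t `^ (r + 1) - c `^ (r + 1)) / (r + 1))%:E)%E.
Proof.
move=> c0; rewrite le_eqVlt => /predU1P[<- _|ct rN1].
  by rewrite subrr mul0r set_itv1 integral_set1.
have r1 : r + 1 != 0 by rewrite addr_eq0.
pose F (x : R) := (r + 1)^-1 * x `^ (r + 1).
have dF x : 0 < x -> is_derive x 1 F (x `^ r).
  move=> x0; have -> : x `^ r = (r + 1)^-1 *: ((r + 1) * x `^ (r + 1 - 1)).
    by rewrite /GRing.scale/= mulrA mulVf// mul1r addrK.
  by apply: is_deriveZ; exact: is_derive1_powR.
have cF x : 0 < x -> {for x, continuous F}.
  move=> x0; apply/differentiable_continuous/derivable1_diffP.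
  exact: (@ex_derive _ _ _ _ _ _ _ (dF x x0)).
rewrite (@continuous_FTC2 _ _ F)//.
- by rewrite -EFinB /F -mulrBr mulrC.
- apply: derivable_within_continuous => x; rewrite in_itv/= => /andP[cx _].
  by apply: derivable_powR; rewrite in_itv/= andbT (lt_le_trans c0).
- split.
  + move=> x; rewrite in_itv/= => /andP[cx _].
    by apply: (@ex_derive _ _ _ _ _ _ _ (dF x _)); exact: lt_trans cx.
  + by apply: cvg_at_right_filter; exact: cF.
  + by apply: cvg_at_left_filter; apply: cF; exact: lt_trans ct.
- move=> x; rewrite in_itv/= => /andP[cx _].
  rewrite derive1E; apply: (@derive_val _ _ _ _ _ _ _ (dF x _)).
  exact: lt_trans cx.
Qed.

(** The integrand may be singular at 0, so the exact formula is applied on [[t / n.+1%:R, t]] and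
    passed to the limit by monotone convergence. Dropping the boundary term at the left end costs
    nothing for an upper bound. *)
Lemma integral_powRN_near0 b t : 0 < t -> b < 1 ->
  (\int[mu]_(x in `]0%R, t]) (x `^ (- b))%:E <= (t `^ (1 - b) / (1 - b))%:E)%E.
Proof.
move=> t0 b1; pose F (n : nat) : set R := `[t / n.+1%:R, t]%classic.
have -> : `]0, t]%classic = \bigcup_n F n.
  apply/seteqP; split => x; rewrite /= ?in_itv/=.
    move=> /andP[x0 xt]; exists (Num.truncn (t / x)) => //.
    rewrite /F/= in_itv/= xt andbT.
    rewrite ler_pdivrMr// mulrC -ler_pdivrMr//; apply/ltW.
    exact: truncnS_gt.
  move=> [n _]; rewrite /F/= in_itv/= => /andP[h ->].
  by rewrite andbT (lt_le_trans _ h)// divr_gt0.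
have cv : (\int[mu]_(x in F n) (x `^ (- b))%:E @[n --> \oo] -->
    \int[mu]_(x in \bigcup_n F n) (x `^ (- b))%:E)%E.
  apply: ge0_nondecreasing_set_cvg_integral.
  - apply/nondecreasing_seqP => n; apply/subsetPset => x.
    rewrite /F/= !in_itv/= => /andP[h ->].
    rewrite andbT (le_trans _ h)// ler_pM2l// lef_pV2 ?posrE//.
    by rewrite ler_nat.
  - by move=> n; exact: measurable_itv.
  - by move=> n; exact: measurable_powR_EFin.
  - by move=> n x _; rewrite lee_fin powR_ge0.
rewrite -(cvg_lim _ cv)//.
apply: lime_le; first by apply: cvgP; exact: cv.
near=> n.
rewrite /F integral_powR ?divr_gt0//.
- rewrite lee_fin (addrC (- b)) ler_pM2r ?invr_gt0 ?subr_gt0// lerBlDr lerDl.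
  exact: powR_ge0.
- by rewrite ler_pdivrMr// ler_peMr ?(ltW t0)// ler1n.
- by rewrite eqr_opp lt_eqF.
Unshelve. all: end_near. Qed.

(** The minimum switches at x = t. Below t only x^(-b) is integrated, which needs b < 1; above t the
    integrand is at most t^r x^(-b-r), whose integral up to infinity is finite as b + r > 1. Both
    pieces scale like t^(1-b). *)
Lemma integral_powR_min b r t : 0 <= b -> b < 1 -> 0 < r -> 1 < b + r ->
  0 < t ->
  (\int[mu]_(x in `[0%R, 1%R])
     (x `^ (- b) * Num.min 1 (t `^ r * x `^ (- r)))%:E <=
   (t `^ (1 - b) * ((1 - b)^-1 + (b + r - 1)^-1))%:E)%E.
Proof.
move=> b0 b1 r0 br1 t0.
pose f x := x `^ (- b) * Num.min 1 (t `^ r * x `^ (- r)).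
have mf D : measurable_fun D (fun x => (f x)%:E).
  apply/measurable_EFinP; apply: measurable_funTS.
  apply: measurable_funM; first exact: measurable_powR.
  apply: measurable_minr => //.
  by apply: measurable_funM => //; exact: measurable_powR.
have f0 x : (0 <= (f x)%:E)%E.
  by rewrite lee_fin mulr_ge0 ?powR_ge0// le_min ler01 mulr_ge0 ?powR_ge0.
rewrite -[leLHS]/(\int[mu]_(x in `[0%R, 1%R]) (f x)%:E)%E.
have bnd1 : (\int[mu]_(x in `]0%R, t]) (f x)%:E <=
    (t `^ (1 - b) / (1 - b))%:E)%E.
  apply: le_trans (integral_powRN_near0 t0 b1).
  apply: ge0_le_integral => //.
  - exact: mf.
  - exact: measurable_powR_EFin.
  - move=> x _; rewrite lee_fin ler_piMr ?powR_ge0// ge_min lexx//.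
(* With the right end [Num.max t 1], the two pieces cover the unit interval whether or not t exceeds
   1. *)
have bnd2 : (\int[mu]_(x in `[t, Num.max t 1%R]) (f x)%:E <=
    (t `^ (1 - b) / (b + r - 1))%:E)%E.
  have tm : t <= Num.max t 1 by rewrite le_max lexx.
  have br : 0 < b + r - 1 by rewrite subr_gt0.
  apply: (@le_trans _ _ (\int[mu]_(x in `[t, Num.max t 1%R])
      ((t `^ r)%:E * (x `^ (- b - r))%:E)))%E.
    apply: ge0_le_integral => //.
    - exact: mf.
    - by apply: emeasurable_funM => //; exact: measurable_powR_EFin.
    - move=> x; rewrite /= in_itv/= => /andP[tx _].
      have x0 : 0 < x by exact: lt_le_trans tx.
      rewrite -EFinM lee_fin /f.
      rewrite powRD; last by rewrite (gt_eqF x0) implybT.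
      by rewrite mulrCA ler_wpM2l ?powR_ge0// ge_min lexx orbT.
  rewrite ge0_integralZl//; last 3 first.
  - exact: measurable_powR_EFin.
  - by move=> x _; rewrite lee_fin powR_ge0.
  - by rewrite lee_fin powR_ge0.
  rewrite integral_powR//; last first.
    by apply/negP => /eqP; lra.
  rewrite -EFinM lee_fin.
  have -> : - b - r + 1 = - (b + r - 1) by lra.
  rewrite invrN mulrN -mulNr opprB mulrA ler_pM2r ?invr_gt0// mulrBr.
  rewrite lerBlDr -powRD; last by rewrite (gt_eqF t0) implybT.
  have -> : r - (b + r - 1) = 1 - b by lra.
  by rewrite lerDl mulr_ge0 ?powR_ge0.
rewrite mulrDr EFinD.
apply: (@le_trans _ _
    (\int[mu]_(x in `]0%R, t] `|` `[t, Num.max t 1%R]) (f x)%:E))%E; last first.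
  have mI : measurable (`]t, Num.max t 1]%classic : set R) by [].
  have -> : `]0, t] `|` `[t, Num.max t 1] = `]0, t] `|` `]t, Num.max t 1].
    apply/seteqP; split => x /=; rewrite !in_itv/= => -[h|/andP[h1 h2]];
      try by left.
      move: h1; rewrite le_eqVlt => /predU1P[<-|h1].
        by left; rewrite t0 lexx.
      by right; rewrite h1 h2.
    by right; rewrite (ltW h1) h2.
  rewrite ge0_integral_setU//; last 2 first.
  - exact: mf.
  - apply/disj_setPS => x [] /=; rewrite !in_itv/= => /andP[_ xt] /andP[+ _].
    by rewrite ltNge xt.
  apply: leeD => //; apply: le_trans bnd2.
  apply: ge0_subset_integral => //; first exact: mf.
  by move=> x /=; rewrite !in_itv/= => /andP[h1 ->]; rewrite andbT ltW.
rewrite -(integral_itv_obnd_cbnd (mf _)).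
apply: ge0_subset_integral => //.
- exact: measurableU.
- exact: mf.
move=> x /=; rewrite !in_itv/= => /andP[h1 h2].
have [xt|xt] := leP x t; [left|right] => /=; first by rewrite h1.
by rewrite (ltW xt) le_max h2 orbT.
Qed.

End PowerIntegrals.

(** * Densities and independence *)

Section IntegralTransfer.
Local Open Scope ereal_scope.
Context {R : realType}.
Import HBNNSimple.

(** Simple functions, then monotone convergence. Allowing a map [Z] besides the density [h] covers
    both laws given by a density ([Z] the identity) and conditional probabilities given [Z]. *)
Lemma ge0_integral_density d1 d2 (X : measurableType d1) (Y : measurableType d2)
    (mu : {measure set X -> \bar R}) (m : {measure set Y -> \bar R})
    (Z : X -> Y) (h : X -> \bar R) (f : Y -> \bar R) :
  measurable_fun setT Z -> measurable_fun setT h -> (forall x, 0 <= h x) ->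
  (forall x, h x \is a fin_num) ->
  (forall B, measurable B -> m B = \int[mu]_(x in Z @^-1` B) h x) ->
  measurable_fun setT f -> (forall y, 0 <= f y) ->
  \int[m]_y f y = \int[mu]_x (f (Z x) * h x).
Proof.
move=> mZ mh h0 hfin mE mf f0.
have mpre B : measurable B -> measurable (Z @^-1` B).
  by move=> mB; rewrite -[_ @^-1` _]setTI; exact: mZ.
have simple (g : {nnsfun Y >-> R}) :
    \int[m]_y (g y)%:E = \int[mu]_x ((g (Z x))%:E * h x).
  under [LHS]eq_integral do rewrite fimfunE -fsumEFin//.
  rewrite [LHS]ge0_integral_fsum//; last 2 first.
    - by move=> r; exact/measurable_EFinP/measurableT_comp.
    - by move=> n x _; rewrite EFinM nnfun_muleindic_ge0.
  under [RHS]eq_integral.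
    move=> x xD; rewrite fimfunE -fsumEFin// ge0_mule_fsuml; last first.
      by move=> r; rewrite EFinM nnfun_muleindic_ge0.
    over.
  rewrite [RHS]ge0_integral_fsum//; last 2 first.
    - move=> r; apply: emeasurable_funM => //; apply/measurable_EFinP.
      by apply: measurable_funM => //; exact: (measurableT_comp _ mZ).
    - by move=> n x _; rewrite mule_ge0// EFinM nnfun_muleindic_ge0.
  apply: eq_fsbigr => r _.
  (* A nonnegative simple function takes no negative value; this leaves r >= 0, so that r can be
     pulled out of the integrals. *)
  have [r0|r0] := ltP r 0%R.
    have e0 : g @^-1` [set r] = set0.
      apply/seteqP; split => // y /= gyr.
      by have : (0 <= g y)%R by []; rewrite gyr leNgt r0.
    by rewrite e0 !integral0_eq// => x _; rewrite indicE in_set0 mulr0 ?mul0e.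
  under eq_integral do rewrite EFinM.
  rewrite ge0_integralZl//; last by apply/measurable_EFinP.
  rewrite integral_indic// setIT mE//.
  under [RHS]eq_integral do rewrite EFinM -muleA.
  rewrite ge0_integralZl//; last 2 first.
  - apply: emeasurable_funM => //; apply/measurable_EFinP.
    by apply: (measurableT_comp _ mZ) => //; exact: measurable_indic.
  - by move=> y _; rewrite mule_ge0// lee_fin.
  congr (_ * _); rewrite integral_mkcond; apply: eq_integral => x _.
  rewrite patchE indicE.
  have -> : (Z x \in g @^-1` [set r]) = (x \in Z @^-1` (g @^-1` [set r])).
    by apply/idP/idP; rewrite !inE.
  by case: ifPn => _; rewrite ?mul1e ?mul0e.
pose f_ := nnsfun_approx measurableT mf.
have cf x : (f_ n x)%:E @[n --> \oo] --> f x by exact: cvg_nnsfun_approx.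
transitivity (limn (fun n => \int[m]_y (f_ n y)%:E)).
  rewrite -monotone_convergence//=.
  - by apply: eq_integral => y _; apply/esym/cvg_lim.
  - by move=> n; exact/measurable_EFinP/measurable_funTS.
  - by move=> n y _; rewrite lee_fin.
  - by move=> y _ a b ab; rewrite lee_fin; exact/lefP/nd_nnsfun_approx.
under eq_fun do rewrite simple.
rewrite -monotone_convergence//=.
- apply: eq_integral => x _; apply/cvg_lim => //.
  by under eq_fun do rewrite muleC; rewrite muleC; exact: cvgeZl.
- move=> n; apply: emeasurable_funM => //; apply/measurable_EFinP.
  exact: measurableT_comp.
- by move=> n x _; rewrite mule_ge0// lee_fin.
- move=> x _ a b ab; rewrite lee_wpmul2r// lee_fin.
  exact/lefP/nd_nnsfun_approx.
Qed.

End IntegralTransfer.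

Section Independence.
Local Open Scope ereal_scope.
Context d (Omega : measurableType d) (R : realType) (P : probability Omega R).

Lemma ge0_integral_indep3 d1 d2 d3 (T1 : measurableType d1)
    (T2 : measurableType d2) (T3 : measurableType d3)
    (X : {mfun Omega >-> T1}) (Y : {mfun Omega >-> T2})
    (Z : {mfun Omega >-> T3}) (f : T1 * (T2 * T3) -> \bar R) :
  (forall A B C, measurable A -> measurable B -> measurable C ->
    P (X @^-1` A `&` (Y @^-1` B `&` Z @^-1` C)) =
    P (X @^-1` A) * (P (Y @^-1` B) * P (Z @^-1` C))) ->
  measurable_fun setT f -> (forall t, 0 <= f t) ->
  \int[P]_w f (X w, (Y w, Z w)) =
  \int[distribution P X]_x \int[distribution P Y]_y
    \int[distribution P Z]_z f (x, (y, z)).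
Proof.
move=> indep mf f0.
have mYZ : measurable_fun setT (fun w => (Y w, Z w)).
  exact: measurable_fun_pair.
have mXYZ : measurable_fun setT (fun w => (X w, (Y w, Z w))).
  exact: measurable_fun_pair.
pose YZ : {mfun Omega >-> (T2 * T3)%type} :=
  HB.pack (fun w => (Y w, Z w)) (isMeasurableFun.Build _ _ _ _ _ mYZ).
pose XYZ : {mfun Omega >-> (T1 * (T2 * T3))%type} :=
  HB.pack (fun w => (X w, (Y w, Z w))) (isMeasurableFun.Build _ _ _ _ _ mXYZ).
have lawYZ D : measurable D ->
    (distribution P Y \x distribution P Z) D = distribution P YZ D.
  apply: product_measure_unique => B C mB mC.
  have := indep _ _ _ measurableT mB mC.
  by rewrite preimage_setT probability_setT mul1e setTI.
have lawXYZ A : measurable A ->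
    (distribution P X \x distribution P YZ) A = distribution P XYZ A.
  apply: product_measure_unique => {}A D mA mD.
  have mXA : measurable (X @^-1` A).
    by rewrite -[_ @^-1` _]setTI; exact: measurable_funP.
  pose c : {nonneg R} := NngNum (fine_ge0 (measure_ge0 (distribution P X) A)).
  have cE : c%:num%:E = P (X @^-1` A) by rewrite /c/= fineK ?fin_num_measure.
  (* For a fixed [A], both P(X in A) P((Y, Z) in E) and P(X in A, (Y, Z) in E) are finite measures
     in E. They agree on rectangles by independence, hence everywhere. *)
  pose m1 := mscale c (distribution P YZ).
  pose m2 := pushforward (mrestr P mXA) YZ.
  have m1E E : m1 E = P (X @^-1` A) * distribution P YZ E by rewrite -cE.
  have m12 : forall E, measurable E -> m1 E = m2 E.
    apply: (measure_unique [set B `*` C | B in measurable & C in measurable]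
      (fun=> setT)) => //.
    - by rewrite measurable_prod_measurableType.
    - move=> _ _ [B1 mB1 [C1 mC1 <-]] [B2 mB2 [C2 mC2 <-]].
      exists (B1 `&` B2); first exact: measurableI.
      by exists (C1 `&` C2); [exact: measurableI|rewrite setXI].
    - by move=> _; exists setT => //; exists setT => //; rewrite setXTT.
    - by rewrite bigcup_const//; exists 0%N.
    - move=> _ [B mB [C mC <-]].
      have mBC : measurable (B `*` C) by exact: measurableX.
      rewrite [LHS]m1E -lawYZ// product_measure1E// -indep//.
      by rewrite /m2 /pushforward/= /mrestr; congr (P _); rewrite setIC.
    - move=> _; rewrite [ltLHS]m1E lte_mul_pinfty// ?fin_num_measure//.
      by rewrite probability_setT ltry.
  transitivity (m2 D).
    by rewrite /m2 /pushforward/= /mrestr; congr (P _); rewrite setIC.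
  by rewrite -m12// [LHS]m1E.
transitivity (\int[distribution P XYZ]_t f t).
  by rewrite ge0_integral_distribution.
transitivity (\int[distribution P X \x distribution P YZ]_t f t).
  by apply: eq_measure_integral => A mA _; apply/esym; exact: lawXYZ.
rewrite fubini_tonelli1//; apply: eq_integral => x _; rewrite /fubini_F.
transitivity (\int[distribution P Y \x distribution P Z]_t f (x, t)).
  by apply: eq_measure_integral => A mA _; apply/esym; exact: lawYZ.
rewrite fubini_tonelli1//.
exact: (measurableT_comp mf).
Qed.

End Independence.

(** * Poisson, uniform and Gamma laws *)

Section PoissonBounds.
Context {R : realType}.
Implicit Types (M y : R) (S : set nat).

Lemma poisson_probE M S : 0 < M ->
  poisson_prob M 0 S = (\esum_(k in S) (poisson_pmf M k)%:E)%E.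
Proof. by move=> M0; rewrite /poisson_prob M0. Qed.

Lemma poisson_pmfE M k : 0 < M ->
  poisson_pmf M k = M ^+ k * k`!%:R^-1 * expR (- M).
Proof. by move=> M0; rewrite /poisson_pmf M0. Qed.

(** The Poisson estimates below all compare each term with a weight at a shifted index; as the shift
    is injective on [S], those weights are distinct and add up to at most 1. *)
Lemma poisson_esum_le M (f : nat -> R) (e : nat -> nat) S (C : R) : 0 < M ->
  0 <= C -> set_inj S e -> (forall k, S k -> f k <= C * poisson_pmf M (e k)) ->
  (\esum_(k in S) (f k)%:E <= C%:E)%E.
Proof.
move=> M0 C0 injS le_f.
apply: (@le_trans _ _ (\esum_(k in S) (C * poisson_pmf M (e k))%:E)%E).
  by apply: le_esum => k Sk; rewrite lee_fin le_f.
rewrite -(@esum_image _ _ _ _ e (fun k => (C * poisson_pmf M k)%:E)) //.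
have pm_ge0 k : (0 <= (C * poisson_pmf M k)%:E)%E.
  by rewrite lee_fin mulr_ge0 ?poisson_pmf_ge0.
apply: (@le_trans _ _ (\esum_(k in [set: nat]) (C * poisson_pmf M k)%:E)%E).
  rewrite esum_mkcond; apply: le_esum => k _; case: ifP => // _.
rewrite -nneseries_esumT//.
under eq_eseriesr do rewrite EFinM.
rewrite nneseriesZl; last by move=> k _; rewrite lee_fin poisson_pmf_ge0.
rewrite nneseries_esumT; last by move=> k; rewrite lee_fin poisson_pmf_ge0.
by rewrite -poisson_probE// probability_setT mule1.
Qed.

Lemma poisson_pmfS M k : 0 < M ->
  poisson_pmf M k.+1 * k.+1%:R = M * poisson_pmf M k.
Proof.
move=> M0; rewrite !poisson_pmfE// exprS factS natrM.
have k0 : k.+1%:R != 0 :> R by rewrite pnatr_eq0.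
have f0 : k`!%:R != 0 :> R by rewrite pnatr_eq0 -lt0n fact_gt0.
move: (k.+1%:R : R) (k`!%:R : R) k0 f0 => u v u0 v0.
by field; rewrite u0 v0.
Qed.

Lemma poisson_pmf_ffact M k p : 0 < M -> (p <= k)%N ->
  poisson_pmf M k * (k ^_ p)%:R = M ^+ p * poisson_pmf M (k - p).
Proof.
move=> M0; elim: p => [|p IH] pk; first by rewrite ffactn0 mulr1 mul1r subn0.
rewrite ffactnSr natrM mulrA IH ?(ltnW pk)// exprSr -!mulrA; congr (_ * _).
by rewrite -{1 2}(subnSK pk) poisson_pmfS.
Qed.

(** Each of the p factors of the falling factorial is at least k - p + 1. *)
Lemma ffact_ge y k p : 0 <= y -> y + p%:R <= k%:R -> y ^+ p <= (k ^_ p)%:R.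
Proof.
move=> y0; elim: p => [|p IH] ypk; first by rewrite expr0 ffactn0.
rewrite ffactnSr natrM exprSr.
have pk : (p <= k)%N by rewrite -(ler_nat R); move: ypk; rewrite -natr1; lra.
apply: ler_pM => //; first exact: exprn_ge0.
  by apply: IH; move: ypk; rewrite -natr1; lra.
by rewrite natrB//; move: ypk; rewrite -natr1; lra.
Qed.

Lemma poisson_prob0 M : 0 <= M ->
  poisson_prob M 0 [set 0%N] = (expR (- M))%:E.
Proof.
rewrite le_eqVlt => /predU1P[<-|M0].
  by rewrite /poisson_prob ltxx diracE mem_set// oppr0 expR0.
rewrite poisson_probE// esum_set1 ?lee_fin ?poisson_pmf_ge0//.
by rewrite poisson_pmfE// expr0 fact0 invr1 !mul1r.
Qed.

(** Markov's inequality for the p-th factorial moment: for a Poisson law it is exactly M^p, without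
    the lower powers of M found in the ordinary moment. *)
Lemma poisson_tail_le M y p : 0 <= M -> 0 < y -> 2 * p%:R <= y ->
  (poisson_prob M 0 [set k : nat | (y <= k%:R)%R] <=
   (Num.min 1 ((2 * M / y) ^+ p))%:E)%E.
Proof.
move=> M0 y0 py; rewrite EFin_min le_min probability_le1//=.
move: M0; rewrite le_eqVlt => /predU1P[<-|M0].
  rewrite /poisson_prob ltxx diracE memNset/=; last by rewrite leNgt y0.
  by rewrite lee_fin mulr0 mul0r exprn_ge0.
rewrite poisson_probE//.
have y2 : 0 < y / 2 by rewrite divr_gt0.
have key k : y <= k%:R -> (p <= k)%N.
  by move=> yk; rewrite -(ler_nat R); have : 0 <= p%:R :> R by []; lra.
(* The weights satisfy w_k * k^_p = M^p * w_(k-p), and k^_p >= (y/2)^p here. *)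
apply: (@poisson_esum_le M _ (fun k => k - p)%N) => //.
- by rewrite exprn_ge0// divr_ge0 ?mulr_ge0// ltW.
- move=> k l /[!inE]/= /key pk /key pl kl.
  by rewrite -(subnK pk) -(subnK pl) kl.
move=> k /= yk; have pk := key _ yk.
have -> : 2 * M / y = M / (y / 2) by field; rewrite gt_eqF.
rewrite expr_div_n mulrAC -poisson_pmf_ffact// -mulrA.
rewrite ler_peMr ?poisson_pmf_ge0// ler_pdivlMr ?exprn_gt0// mul1r.
apply: ffact_ge; first exact: ltW.
lra.
Qed.

(** Consecutive weights have ratio M / (k + 1), which is at least 2 for k < y. So the weights below
    y are at most half of their successors, and carry at most half of the mass. *)
Lemma poisson_tail_ge M y : 0 <= y -> 2 * (y + 1) <= M ->
  ((1 / 2)%:E <= poisson_prob M 0 [set k : nat | (y <= k%:R)%R])%E.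
Proof.
move=> y0 yM; have M0 : 0 < M by lra.
have -> : [set k : nat | y <= k%:R] = ~` [set k | k%:R < y].
  by apply/seteqP; split => k /=; rewrite leNgt => /negP.
rewrite probability_setC//.
suff : (poisson_prob M 0 [set k : nat | (k%:R < y)%R] <= (1 / 2)%:E)%E.
  move=> h; rewrite -[leLHS](_ : 1 - (1/2)%:E = _)%E; last first.
    by rewrite -EFinB; congr (_%:E); lra.
  exact: leeB.
rewrite poisson_probE//.
apply: (@poisson_esum_le M _ S) => //; first by move=> k l _ _ [].
move=> k /= ky.
have k1 : 0 < k.+1%:R :> R by rewrite ltr0n.
have -> : poisson_pmf M k.+1 = M * poisson_pmf M k / k.+1%:R.
  by rewrite -poisson_pmfS// mulfK// gt_eqF.
have -> : 1 / 2 * (M * poisson_pmf M k / k.+1%:R) =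
    M / (2 * k.+1%:R) * poisson_pmf M k by field; rewrite gt_eqF.
rewrite ler_peMl ?poisson_pmf_ge0// ler_pdivlMr ?mulr_gt0// -natr1; lra.
Qed.

(** The tails of an integer variable add up to its mean, and k w_k = M w_(k-1) for the Poisson
    weights. *)
Lemma poisson_sum_tail_le M : 0 <= M ->
  (\sum_(j <oo) poisson_prob M 0 [set k | (j < k)%N] <= M%:E)%E.
Proof.
rewrite le_eqVlt => /predU1P[<-|M0].
  by rewrite eseries0// => j _ _; rewrite /poisson_prob ltxx diracE memNset.
have w0 k : (0 <= (poisson_pmf M k)%:E)%E by rewrite lee_fin poisson_pmf_ge0.
pose a j k : \bar R := (if (j < k)%N then (poisson_pmf M k)%:E else 0)%E.
have a0 j k : (0 <= a j k)%E by rewrite /a; case: ifP.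
rewrite [leLHS](_ : _ = \sum_(j <oo) \sum_(k <oo) a j k)%E; last first.
  apply: eq_eseriesr => j _.
  rewrite poisson_probE// nneseries_esumT// esum_mkcond; apply: eq_esum => k _.
  by rewrite /a; congr (if _ then _ else _); apply/idP/idP; rewrite inE.
rewrite nneseries_interchange//.
rewrite [leLHS](_ : _ = \sum_(k <oo) (k%:R * poisson_pmf M k)%:E)%E; last first.
  apply: eq_eseriesr => k _.
  rewrite (nneseries_split _ k); last by move=> j _.
  rewrite [X in (_ + X)%E]eseries0 ?adde0; last first.
    by move=> j; rewrite add0n /a ltnNge => ->.
  rewrite add0n big_mkord (eq_bigr (fun=> (poisson_pmf M k)%:E)).
    by rewrite sumEFin sumr_const card_ord mulr_natl.
  by move=> j _; rewrite /a ltn_ord.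
rewrite nneseries_esumT; last first.
  by move=> k; rewrite lee_fin mulr_ge0 ?poisson_pmf_ge0.
rewrite (esumID [set 0%N]); last first.
  by move=> k _; rewrite lee_fin mulr_ge0 ?poisson_pmf_ge0.
rewrite esum1 ?add0e; last by move=> k [_ ->]; rewrite mul0r.
apply: (@poisson_esum_le M _ predn) => //; first exact: ltW.
- by move=> [|k] [|l] /[!inE]/= -[_ h1] [_ h2] //= ->.
- by move=> [|k] [_ /= k0] //; rewrite mulrC poisson_pmfS.
Qed.

End PoissonBounds.

Section UniformLaw.
Local Open Scope ereal_scope.
Context d (Omega : measurableType d) (R : realType) (P : probability Omega R).
Variable U : {RV P >-> R}.
Hypothesis lawU : forall B, measurable B ->
  distribution P U B = uniform_prob (@ltr01 R) B.

Lemma integral_uniform_law (f : R -> \bar R) : measurable_fun setT f ->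
  (forall x, 0 <= f x) ->
  \int[distribution P U]_x f x =
  \int[lebesgue_measure]_(x in `[0%R, 1%R]) f x.
Proof.
move=> mf f0.
(* [uniform_prob] is a measure on [measurableTypeR R], whose display differs
   from the one of the codomain of [U]; the identity serves as a transfer map. *)
rewrite (@ge0_integral_density _ _ _ _ R lebesgue_measure _ id
  (EFin \o uniform_pdf 0%R 1%R))//=; last 2 first.
- by apply/measurable_EFinP; exact: measurable_uniform_pdf.
- by move=> x; rewrite lee_fin uniform_pdf_ge0.
rewrite [RHS]integral_mkcond; apply: eq_integral => x _.
rewrite patchE /uniform_pdf; case: ifPn => x01.
  by rewrite ifT ?subr0 ?invr1 ?mule1// mem_setE.
by rewrite ifF ?mule0//; apply/negbTE; rewrite mem_setE.
Qed.

Lemma uniform_law_itv (s t : R) : (0 <= s <= t)%R -> (t <= 1)%R ->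
  P (U @^-1` `]s, t]) = (t - s)%:E.
Proof.
move=> /andP[s0 st] t1.
have := lawU (measurable_itv `]s, t]).
rewrite /distribution/= /pushforward /= => ->.
rewrite /uniform_prob integral_uniform_pdf setIidl; last first.
  move=> x /=; rewrite !in_itv/= => /andP[sx xt].
  by rewrite (le_trans s0 (ltW sx)) (le_trans xt).
rewrite (eq_integral (fun=> 1)); last first.
  move=> x; rewrite inE/= in_itv/= => /andP[sx xt].
  by rewrite /uniform_pdf (le_trans s0 (ltW sx)) (le_trans xt)//= subr0 invr1.
rewrite integral_cst// mul1e.
apply: etrans (lebesgue_measure_itv `]s, t]) _; rewrite /= lte_fin.
case: ltgtP st => // -> _; by rewrite subrr.
Qed.

End UniformLaw.

Section GammaLaw.
Context d (Omega : measurableType d) (R : realType) (P : probability Omega R).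
Variables (X : {RV P >-> R}) (a : R).
Hypothesis lawX : forall B, measurable B ->
  distribution P X B = gamma_prob a B.

Lemma gamma_fun_ge0 : 0 <= gamma_fun a.
Proof.
by apply: Rintegral_ge0 => x _; rewrite mulr_ge0 ?powR_ge0 ?expR_ge0.
Qed.

Lemma gamma_pdf_ge0 x : 0 <= gamma_pdf a x.
Proof.
rewrite /gamma_pdf; case: ifP => // _.
by rewrite divr_ge0 ?gamma_fun_ge0// mulr_ge0 ?powR_ge0 ?expR_ge0.
Qed.

Lemma measurable_gamma_pdf : measurable_fun setT (gamma_pdf a).
Proof.
apply: measurable_fun_ifT => //; first exact: measurable_fun_ltr.
apply: measurable_funM => //; apply: measurable_funM.
  exact: measurable_powR.
by apply: measurableT_comp => //; exact: measurable_funN.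
Qed.

Lemma gamma_law_le0 : P (X @^-1` `]-oo, 0%R]) = 0%E.
Proof.
have := lawX (measurable_itv `]-oo, 0%R]).
rewrite /distribution/= /pushforward/= => ->.
rewrite /gamma_prob integral0_eq// => x /=; rewrite in_itv/= => x0.
by rewrite /gamma_pdf ltNge x0.
Qed.

(** This is u <= exp u at u = x / (2r), raised to the power r. *)
Lemma powR_le_expR (r x : R) : 0 < r -> 0 <= x ->
  x `^ r <= (2 * r) `^ r * expR (x / 2).
Proof.
move=> r0 x0; have r2 : 0 < 2 * r by rewrite mulr_gt0.
have xe : x <= 2 * r * expR (x / (2 * r)).
  have := expR_ge1Dx (x / (2 * r)) => h.
  rewrite mulrC -ler_pdivrMr//; apply: le_trans h; lra.
apply: (@le_trans _ _ ((2 * r * expR (x / (2 * r))) `^ r)).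
  apply: ge0_ler_powR => //; rewrite ?nnegrE ?(ltW r0)//.
  by rewrite mulr_ge0 ?expR_ge0 ?(ltW r2).
rewrite powRM ?expR_ge0 ?(ltW r2)// -expRM.
suff -> : x / (2 * r) * r = x / 2 by [].
by field; rewrite gt_eqF.
Qed.

(** Below 1 the power x^q is at most 1 and the density itself dominates; above 1 half of the
    exponential absorbs all powers, leaving an exponential density of rate 1/2. *)
Lemma gamma_law_moment (q : R) : 0 <= q ->
  (\int[distribution P X]_x (x `^ q)%:E < +oo)%E.
Proof.
move=> q0.
have mpdf : measurable_fun setT (EFin \o gamma_pdf a).
  by apply/measurable_EFinP; exact: measurable_gamma_pdf.
have mexp : measurable_fun setT (EFin \o exponential_pdf (2^-1 : R)).
  by apply/measurable_EFinP; exact: measurable_exponential_pdf.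
have mpow : measurable_fun setT (EFin \o (fun x : R => x `^ q)).
  by apply/measurable_EFinP; exact: measurable_powR.
rewrite (@ge0_integral_density _ _ _ _ R lebesgue_measure _ id
  (EFin \o gamma_pdf a))//=; last 2 first.
- by move=> x; rewrite lee_fin gamma_pdf_ge0.
- by move=> x; rewrite lee_fin powR_ge0.
(* Any positive exponent that is at least q + a - 1 would do; the absolute value secures this for
   every real a. The factor 2 in [C] cancels the rate in the exponential density. *)
pose r := `|q + a| + 1.
have r0 : 0 < r by rewrite ltr_wpDl.
pose C := 2 * ((2 * r) `^ r / gamma_fun a).
have C0 : 0 <= C by rewrite mulr_ge0// divr_ge0 ?powR_ge0 ?gamma_fun_ge0.
have bnd x : x `^ q * gamma_pdf a x <=
    gamma_pdf a x + C * exponential_pdf (2^-1) x.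
  have e0 : 0 <= exponential_pdf (2^-1 : R) x by exact: exponential_pdf_ge0.
  have [x0|x0] := leP x 0.
    by rewrite /gamma_pdf ltNge x0/= mulr0 add0r mulr_ge0.
  have [x1|x1] := leP x 1.
    apply: (@le_trans _ _ (gamma_pdf a x)); last by rewrite lerDl mulr_ge0.
    rewrite ler_piMl ?gamma_pdf_ge0//.
    by rewrite -(powRr0 x) ger_powR ?x0.
  apply: (@le_trans _ _ (C * exponential_pdf 2^-1 x)); last first.
    by rewrite lerDr gamma_pdf_ge0.
  rewrite exponential_pdfE ?(ltW x0)// /gamma_pdf x0.
  have -> : x `^ q * (x `^ (a - 1) * expR (- x) / gamma_fun a) =
      x `^ (q + (a - 1)) * expR (- x) / gamma_fun a.
    rewrite (@powRD _ x q); last by rewrite (gt_eqF x0) implybT.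
    by rewrite !mulrA.
  have -> : C * (2^-1 * expR (- 2^-1 * x)) =
      (2 * r) `^ r * expR (- 2^-1 * x) / gamma_fun a.
    by rewrite /C; move: (gamma_fun a)^-1 (expR _) => u v; field.
  rewrite ler_wpM2r ?invr_ge0 ?gamma_fun_ge0//.
  have -> : expR (- x) = expR (- (x / 2)) * expR (- 2^-1 * x).
    by rewrite -expRD; congr expR; lra.
  rewrite mulrA ler_wpM2r ?expR_ge0//.
  rewrite expRN ler_pdivrMr ?expR_gt0//.
  apply: le_trans (powR_le_expR r0 (ltW x0)).
  apply: ler_powR; first exact: ltW.
  by rewrite /r; have := ler_norm (q + a); lra.
apply: (@le_lt_trans _ _ (\int[lebesgue_measure]_x
    ((gamma_pdf a x)%:E + C%:E * (exponential_pdf 2^-1 x)%:E))%E).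
  apply: ge0_le_integral => //.
  - by move=> x _; rewrite mule_ge0// lee_fin ?powR_ge0 ?gamma_pdf_ge0.
  - exact: emeasurable_funM.
  - by apply: emeasurable_funD => //; exact: emeasurable_funM.
  - by move=> x _; rewrite -!EFinM -EFinD lee_fin.
rewrite ge0_integralD//; last 3 first.
- by move=> x _; rewrite lee_fin gamma_pdf_ge0.
- by move=> x _; rewrite mule_ge0// lee_fin// exponential_pdf_ge0.
- exact: emeasurable_funM.
rewrite ge0_integralZl//; last first.
- by move=> x _; rewrite lee_fin exponential_pdf_ge0.
rewrite integral_exponential_pdf// mule1 lte_add_pinfty ?ltry//.
(* The total mass of the density is read off from its being the law of [X], not from the value of
   [gamma_fun a]. *)
have := lawX measurableT; rewrite probability_setT /gamma_prob => <-.
by rewrite ltry.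
Qed.

End GammaLaw.

(** * Conditionally Poisson counts in the tree *)

Section CondPoisson.
Context d (Omega : measurableType d) (R : realType) (P : probability Omega R).

Lemma measurable_poisson_prob_set (S : set nat) :
  measurable_fun setT (fun r : R => poisson_prob r 0 S).
Proof.
apply: measurable_fun_if => //=; first exact: measurable_fun_ltr.
apply: (eq_measurable_fun (fun t : R =>
    \sum_(k <oo | k \in S) (poisson_pmf t k)%:E)%E).
  move=> x _.
  rewrite nneseries_esum ?set_mem_set// => *.
  by rewrite lee_fin poisson_pmf_ge0.
apply: ge0_emeasurable_sum.
  by move=> k x _ _; rewrite lee_fin poisson_pmf_ge0.
move=> k Sk; apply/measurableT_comp => //.
apply: measurable_poisson_pmf => //.
rewrite setTI.
have -> : (fun x : R => 0 < x) @^-1` [set true] = `]0, +oo[%classic.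
  by apply/seteqP; split => /= x /=; rewrite in_itv/= andbT.
exact: measurable_itv.
Qed.

Lemma npointsT (xi : Omega -> seq R) w : npoints xi setT w = size (xi w).
Proof.
rewrite /npoints (eq_count (a2 := predT)) ?count_predT// => x.
by rewrite in_setT.
Qed.

(** The form in which the Poisson hypothesis is used: all points are counted, and single counts are
    summed over [S]. A separate [m] is allowed because the closed form of the mean, which is visibly
    measurable, is valid only on suitable events [F]. *)
Lemma cond_poisson_size G E (xi : Omega -> seq R) mean F (m : Omega -> R)
    (S : set nat) :
  cond_poisson_process P G E xi mean -> G F -> measurable (F `&` E) ->
  measurable_fun setT (npoints xi setT) -> measurable_fun (F `&` E) m ->
  (forall w, (F `&` E) w -> mean w setT = m w) ->
  P (F `&` E `&` [set w | S (size (xi w))]) =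
  (\int[P]_(w in F `&` E) poisson_prob (m w) 0 S)%E.
Proof.
move=> xiP GF mFE mxi mm meanE.
have mk (A : set nat) : measurable (F `&` E `&` [set w | A (size (xi w))]).
  apply: measurableI => //.
  have -> : [set w | A (size (xi w))] = npoints xi setT @^-1` A.
    by apply/seteqP; split => w /=; rewrite npointsT.
  by rewrite -[_ @^-1` _]setTI; exact: mxi.
have one k : P (F `&` E `&` [set w | size (xi w) = k]) =
    (\int[P]_(w in F `&` E) poisson_prob (m w) 0 [set k])%E.
  have /= := xiP F 1%N (fun=> setT) (fun=> k) GF (fun=> measurableT).
  have tI : trivIset setT (fun _ : 'I_1 => [set: R]).
    by move=> i j _ _ _; rewrite !ord1.
  move=> /(_ tI).
  have -> : [set w | 'I_1 -> npoints xi setT w = k] =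
            [set w | size (xi w) = k].
    apply/seteqP; split => w /=; first by move=> /(_ ord0); rewrite npointsT.
    by move=> h _; rewrite npointsT.
  move=> ->; apply: eq_integral => w /[!inE] FEw.
  by rewrite big_ord1 meanE.
have -> : F `&` E `&` [set w | S (size (xi w))] =
    \bigcup_(k in S) (F `&` E `&` [set w | size (xi w) = k]).
  apply/seteqP; split => w /=; first by move=> [FEw Sw]; exists (size (xi w)).
  by move=> [k Sk [FEw ->]].
rewrite measure_bigcup//; last 2 first.
- by move=> k _; exact: (mk [set k]).
- by move=> i j _ _ [w [[_ /= ->] [_ /= ->]]].
transitivity (\sum_(k <oo | k \in S)
    \int[P]_(w in F `&` E) poisson_prob (m w) 0 [set k])%E.
  by apply: eq_eseriesr => k _; exact: one.
have -> : (\int[P]_(w in F `&` E) poisson_prob (m w) 0 S =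
  \int[P]_(w in F `&` E) \sum_(k <oo) (if k \in S then
     poisson_prob (m w) 0 [set k] else 0))%E.
  apply: eq_integral => w _.
  have {1}-> : S = \bigcup_(k in S) [set k].
    apply/seteqP; split => k; first by move=> Sk; exists k.
    by move=> [l Sl ->].
  rewrite measure_bigcup//; last by move=> i j _ _ [x [/= <- <-]].
  by rewrite eseries_mkcond.
rewrite integral_nneseries//; last 2 first.
- move=> k; case: (k \in S) => //.
  exact: (measurableT_comp (measurable_poisson_prob_set [set k]) mm).
- by move=> k w _; case: ifP.
rewrite eseries_mkcond; apply: eq_eseriesr => k _.
by case: ifP => // _; rewrite integral0.
Qed.

End CondPoisson.

(** * Means of the counts, and events that may be conditioned on *)

Section Tree.
Context (d : measure_display) (Omega : measurableType d) (R : realType)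
  (P : probability Omega R) (delta : R) (hdelta : -1 < delta)
  (T : ppt_data P) (hT : is_polya_point_tree delta T).

Let delta1 : 0 < 1 + delta. Proof. by move: hdelta => h; lra. Qed.
Let delta2 : 0 < 2 + delta. Proof. by move: hdelta => h; lra. Qed.

(** Since 1 - (1 + delta)/(2 + delta) = 1/(2 + delta), the intensity has an explicit primitive. The
    maximum with 0 accounts for ages above 1, where the interval of integration is empty. *)
Lemma mean_youngerE u w : 0 < age delta T u w -> 0 <= ppt_Gamma T u w ->
  mean_younger delta T u w setT =
  ppt_Gamma T u w * Num.max 0 (age delta T u w `^ (- (1 / (2 + delta))) - 1).
Proof.
rewrite /mean_younger /intensity.
move: (ppt_Gamma T u w) (age delta T u w) => g t t0 g0; rewrite setTI.
pose s := 2 + delta; have s0 : 0 < s by [].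
have sE : - ((1 + delta) / (2 + delta)) + 1 = 1 / s.
  by rewrite /s; field; rewrite gt_eqF.
have [t1|t1] := leP t 1; last first.
  rewrite set_itv_ge; last by rewrite bnd_simp -ltNge.
  rewrite Rintegral_set0 (max_idPl _) ?mulr0// subr_le0.
  rewrite -[leRHS](powRr0 t) ler_powR ?(ltW t1)//.
  by rewrite oppr_le0 divr_ge0 ?(ltW delta2).
have c0 : 0 <= g / s / t `^ (1 / s).
  by rewrite !divr_ge0 ?powR_ge0 ?(ltW s0).
rewrite /Rintegral.
have -> : (\int[lebesgue_measure]_(x in `[t, 1%R])
    (g / (2 + delta) * (x `^ (- ((1 + delta) / (2 + delta))) /
       t `^ (1 / (2 + delta))))%:E =
  \int[lebesgue_measure]_(x in `[t, 1%R]) ((g / s / t `^ (1 / s))%:E *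
      (x `^ (- ((1 + delta) / (2 + delta))))%:E))%E.
  by apply: eq_integral => x _; rewrite -EFinM mulrA mulrAC.
rewrite ge0_integralZl_EFin//; last 2 first.
- by move=> x _; rewrite lee_fin powR_ge0.
- exact: measurable_powR_EFin.
rewrite integral_powR//; last first.
  by rewrite -subr_eq0 opprK sE gt_eqF// divr_gt0.
rewrite sE powR1 /=.
have ts0 : 0 < t `^ (1 / s) by exact: powR_gt0.
rewrite powRN (max_idPr _); last first.
  rewrite subr_ge0 invf_ge1// -[leRHS](powRr0 t).
  by rewrite ger_powR ?t0// divr_ge0 ?(ltW s0).
by field; rewrite !gt_eqF.
Qed.


(** The generators of [sigma_outside T u], named so that [g_sigma_algebraType (outside_gens u)] can
    be formed: the closure properties of measurable sets then apply to [sigma_outside]. *)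
Definition outside_gens (u : vertex) : set (set Omega) :=
  [set A | (exists i B, measurable B /\ A = noise T i @^-1` B) \/
           (exists v B n, [/\ ~~ suffix u v, measurable B &
              A = [set w | npoints (ppt_younger T v) B w = n]])].

Lemma sigma_outside_preimage u (i : vertex + vertex) (B : set R) :
  measurable B -> sigma_outside T u (noise T i @^-1` B).
Proof.
by move=> mB; apply: sub_sigma_algebra; left; exists i, B.
Qed.

Lemma sigma_outside_noise u (i : vertex + vertex) :
  measurable_fun setT (noise T i : g_sigma_algebraType (outside_gens u) -> R).
Proof.
by move=> _ B mB; rewrite setTI; exact: sigma_outside_preimage.
Qed.

Lemma sigma_outside_npoints u v (B : set R) : ~~ suffix u v -> measurable B ->
  measurable_fun setT (npoints (ppt_younger T v) B :
    g_sigma_algebraType (outside_gens u) -> nat).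
Proof.
move=> uv mB _ A _; rewrite setTI.
have -> : npoints (ppt_younger T v) B @^-1` A =
    \bigcup_(n in A) [set w | npoints (ppt_younger T v) B w = n].
  apply/seteqP; split => w /= => [Aw|[n An ->]//].
  by exists (npoints (ppt_younger T v) B w).
apply: (@bigcup_measurable _ (g_sigma_algebraType (outside_gens u))) => n _.
by apply: sub_sigma_algebra; right; exists v, B, n.
Qed.

Lemma measurable_npoints_preimage u (B : set R) (A : set nat) : measurable B ->
  measurable [set w | A (npoints (ppt_younger T u) B w)].
Proof.
move=> mB; rewrite -[X in measurable X]setTI.
exact: (ppt_younger_measurable hT u mB).
Qed.

Lemma measurable_size_preimage u (A : set nat) :
  measurable [set w | A (size (ppt_younger T u w))].
Proof.
have := measurable_npoints_preimage u A measurableT.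
by under eq_set do rewrite npointsT.
Qed.

Lemma sigma_outside_measurable u A : sigma_outside T u A -> measurable A.
Proof.
apply: smallest_sub; first exact: sigma_algebra_measurable.
move=> _ [[i [B [mB ->]]]|[v [B [n [_ mB ->]]]]].
  exact: measurable_funPTI.
exact: (measurable_npoints_preimage v [set n] mB).
Qed.

(** As the list is sorted, its i-th entry is below y exactly when more than i points are; beyond the
    end of the list the default value 0 is compared with y. *)
Lemma measurable_nth_younger u i :
  measurable_fun setT (fun w => nth 0 (ppt_younger T u w) i).
Proof.
apply: (measurability _ (RGenInftyO.measurableE R)) => //.
move=> _ [_ [y ->] <-].
have -> : setT `&` (fun w => nth 0 (ppt_younger T u w) i) @^-1` `]-oo, y[ =
   [set w | i < npoints (ppt_younger T u) `]-oo, y[%classic w]%N `|`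
   ([set w | size (ppt_younger T u w) <= i]%N `&` [set w | 0 < y]).
  rewrite setTI; apply/seteqP; split => w; rewrite /= in_itv/=.
    have [iz yn|iz yn] := ltnP i (size (ppt_younger T u w)).
      left; rewrite ltnNge; apply/negP => h.
      move: yn; rewrite ltNge => /negP; apply.
      apply: nth_count_ge; first exact: ppt_younger_sorted hT u w.
      rewrite iz andbT (leq_trans _ h)// /npoints.
      by apply/eq_leq/eq_count => x; apply/idP/idP; rewrite inE/= in_itv.
    by right; split => //; rewrite nth_default in yn.
  move=> [h|[h1 h2]]; last by rewrite nth_default.
  apply: nth_count_lt; first exact: ppt_younger_sorted hT u w.
  apply: leq_trans h _; rewrite /npoints.
  by apply/eq_leq/eq_count => x; apply/idP/idP; rewrite inE/= in_itv.
apply: measurableU.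
  exact: (measurable_npoints_preimage u [set n | (i < n)%N] (measurable_itv _)).
apply: measurableI.
  exact: (measurable_size_preimage u [set n | (n <= i)%N]).
have [y0|y0] := boolP (0 < y).
  by rewrite (_ : mkset _ = setT)//; apply/seteqP; split.
by rewrite (_ : mkset _ = set0)//; apply/seteqP; split.
Qed.

End Tree.

(** * Upper bounds on the tails *)

Section Moments.
Local Open Scope ereal_scope.
Context d (Omega : measurableType d) (R : realType) (P : probability Omega R).

(** Here [h] acts as the conditional probability of [D] given [Z], and may replace the indicator of
    [D] in front of any function of [Z]. *)
Lemma ge0_integral_density_in d1 d2 (X : measurableType d1)
    (Y : measurableType d2) (mu : {measure set X -> \bar R}) (D : set X)
    (Z : X -> Y) (h : X -> \bar R) (f : Y -> \bar R) : measurable D ->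
  measurable_fun setT Z -> measurable_fun setT h -> (forall x, 0 <= h x) ->
  (forall x, h x \is a fin_num) ->
  (forall B, measurable B ->
     mu (Z @^-1` B `&` D) = \int[mu]_(x in Z @^-1` B) h x) ->
  measurable_fun setT f -> (forall y, 0 <= f y) ->
  \int[mu]_(x in D) f (Z x) = \int[mu]_x (f (Z x) * h x).
Proof.
move=> mD mZ mh h0 hfin muE mf f0.
pose Z' : {mfun X >-> Y} := HB.pack Z (isMeasurableFun.Build _ _ _ _ _ mZ).
rewrite -(@ge0_integral_density _ _ _ _ _ mu (pushforward (mrestr mu mD) Z'))//.
rewrite [RHS]ge0_integral_pushforward// preimage_setT.
rewrite (@ge0_integral_density _ _ _ _ _ mu (mrestr mu mD) id
  (EFin \o \1_D))//=.
- rewrite integral_mkcond; apply: eq_integral => x _.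
  by rewrite patchE indicE; case: ifPn => _; rewrite ?mule1 ?mule0.
- by apply/measurable_EFinP; exact: measurable_indic.
- by move=> B mB; rewrite preimage_id integral_indic// setIC.
- exact: (measurableT_comp mf).
Qed.

(** Common core of the two upper bounds; [Z] is the uniform variable behind the heavy factor.
    Integrating over [Z] first, at t = c f2(X) f3(Y), gives a multiple of t^(1-b), which splits into
    a function of [X] times a function of [Y]. *)
Lemma truncated_moment_le (X Y Z : {RV P >-> R}) (b r c : R)
    (f1 f2 f3 : R -> R) :
  (forall A B C, measurable A -> measurable B -> measurable C ->
    P (X @^-1` A `&` (Y @^-1` B `&` Z @^-1` C)) =
    P (X @^-1` A) * (P (Y @^-1` B) * P (Z @^-1` C))) ->
  (forall B, measurable B ->
    distribution P Z B = uniform_prob (@ltr01 R) B) ->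
  (0 <= b)%R -> (b < 1)%R -> (0 < r)%R -> (1 < b + r)%R -> (0 < c)%R ->
  measurable_fun setT f1 -> measurable_fun setT f2 -> measurable_fun setT f3 ->
  (forall x, 0 <= f1 x)%R -> (forall x, 0 <= f2 x)%R ->
  (forall x, 0 <= f3 x)%R ->
  \int[P]_w (f1 (X w) * (Z w `^ (- b) *
    Num.min 1 ((c * f2 (X w) * f3 (Y w)) `^ r * Z w `^ (- r))))%:E <=
  (c `^ (1 - b) * ((1 - b)^-1 + (b + r - 1)^-1))%:E *
  ((\int[distribution P X]_x (f1 x * f2 x `^ (1 - b))%:E) *
   (\int[distribution P Y]_y (f3 y `^ (1 - b))%:E)).
Proof.
move=> indep lawZ b0 b1 r0 br c0 mf1 mf2 mf3 f10 f20 f30.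
pose k z t := (z `^ (- b) * Num.min 1 (t `^ r * z `^ (- r)))%R.
have k0 z t : (0 <= k z t)%R.
  by rewrite mulr_ge0 ?powR_ge0// le_min ler01 mulr_ge0 ?powR_ge0.
pose K := ((1 - b)^-1 + (b + r - 1)^-1)%R.
have K0 : (0 <= K)%R by rewrite addr_ge0// invr_ge0; lra.
pose f (t : R * (R * R)) : \bar R :=
  (f1 t.1 * k t.2.2 (c * f2 t.1 * f3 t.2.1))%:E.
have m22 : measurable_fun setT (fun t : R * (R * R) => t.2.2).
  exact: (measurableT_comp measurable_snd measurable_snd).
have m21 : measurable_fun setT (fun t : R * (R * R) => t.2.1).
  exact: (measurableT_comp measurable_fst measurable_snd).
have m1 : measurable_fun setT (fun t : R * (R * R) => t.1).
  exact: measurable_fst.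
have mf : measurable_fun setT f.
  apply/measurable_EFinP; apply: measurable_funM.
    exact: (measurableT_comp mf1).
  apply: measurable_funM; first exact: (measurableT_comp (measurable_powR _)).
  apply: measurable_minr => //; apply: measurable_funM.
    apply: (measurableT_comp (measurable_powR _)).
    apply: measurable_funM; last exact: (measurableT_comp mf3).
    by apply: measurable_funM => //; exact: (measurableT_comp mf2).
  exact: (measurableT_comp (measurable_powR _)).
have f0 t : 0 <= f t by rewrite lee_fin mulr_ge0.
rewrite -[leLHS]/(\int[P]_w f (X w, (Y w, Z w))) ge0_integral_indep3//.
pose D1 x := (f1 x * f2 x `^ (1 - b))%R.
pose D3 y := (f3 y `^ (1 - b))%R.
have mD1 : measurable_fun setT (EFin \o D1).
  apply/measurable_EFinP; apply: measurable_funM => //.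
  exact: (measurableT_comp (measurable_powR _)).
have mD3 : measurable_fun setT (EFin \o D3).
  by apply/measurable_EFinP; exact: (measurableT_comp (measurable_powR _)).
have D10 x : (0 <= D1 x)%R by rewrite mulr_ge0 ?powR_ge0.
have D30 x : (0 <= D3 x)%R by rewrite powR_ge0.
have inner x y : \int[distribution P Z]_z f (x, (y, z)) <=
    (c `^ (1 - b) * K * (D1 x * D3 y))%:E.
  have mk t : measurable_fun setT (fun z : R => (k z t)%:E).
    apply/measurable_EFinP; apply: measurable_funM.
      exact: measurable_powR.
    apply: measurable_minr; first exact: measurable_cst.
    by apply: measurable_funM; [exact: measurable_cst|exact: measurable_powR].
  rewrite /f /=; under eq_integral do rewrite EFinM.
  rewrite ge0_integralZl//; last 2 first.
  - by move=> z _; rewrite lee_fin.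
  - by rewrite lee_fin.
  rewrite (integral_uniform_law lawZ)//; last by move=> z; rewrite lee_fin.
  have t0 : (0 <= c * f2 x * f3 y)%R by rewrite !mulr_ge0// ltW.
  have kle : \int[lebesgue_measure]_(z in `[0%R, 1%R])
      (k z (c * f2 x * f3 y))%:E <= ((c * f2 x * f3 y) `^ (1 - b) * K)%:E.
    (* [integral_powR_min] asks for t > 0; at t = 0 the truncated power vanishes because r > 0. *)
    move: t0; rewrite le_eqVlt => /predU1P[<-|t0]; last first.
      exact: integral_powR_min.
    rewrite powR0 ?mul0r; last by rewrite subr_eq0 gt_eqF.
    rewrite integral0_eq// => z _.
    by rewrite /k powR0 ?mul0r ?gt_eqF// min_r// mulr0.
  apply: le_trans (lee_wpmul2l _ kle) _; first by rewrite lee_fin.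
  rewrite -EFinM lee_fin /D1 /D3 powRM ?mulr_ge0 ?(ltW c0)//.
  rewrite powRM ?(ltW c0)//.
  by rewrite le_eqVlt; apply/orP; left; apply/eqP; ring.
have mz x :
    measurable_fun setT (fun y => \int[distribution P Z]_z f (x, (y, z))).
  pose g (t : R * R) := f (x, t).
  have mg : measurable_fun setT g by exact: (measurableT_comp mf).
  by apply: (measurable_fun_fubini_tonelli_F g) => // t;
    exact: f0 || exact: integral_ge0.
have inner2 x :
    \int[distribution P Y]_y \int[distribution P Z]_z f (x, (y, z)) <=
    (c `^ (1 - b) * K * D1 x)%:E * \int[distribution P Y]_y (D3 y)%:E.
  rewrite -ge0_integralZl//; last 2 first.
  - by move=> y _; rewrite lee_fin.
  - by rewrite lee_fin !mulr_ge0// powR_ge0.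
  apply: ge0_le_integral => //.
  - by move=> y _; exact: integral_ge0.
  - exact: emeasurable_funM.
  - by move=> y _; apply: le_trans (inner x y) _; rewrite -EFinM mulrA.
have mxyz : measurable_fun setT
    (fun x => \int[distribution P Y]_y \int[distribution P Z]_z f (x, (y, z))).
  pose g (t : R * R) := \int[distribution P Z]_z f (t.1, (t.2, z)).
  have mg : measurable_fun setT g.
    pose h (t : (R * R) * R) := f (t.1.1, (t.1.2, t.2)).
    have mh : measurable_fun setT h.
      apply: (measurableT_comp mf); apply: measurable_fun_pair.
        exact: (measurableT_comp measurable_fst measurable_fst).
      apply: measurable_fun_pair => //.
      exact: (measurableT_comp measurable_snd measurable_fst).
    by apply: (measurable_fun_fubini_tonelli_F h) => // t; exact: f0.
  by apply: (measurable_fun_fubini_tonelli_F g) => // t;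
    exact: f0 || exact: integral_ge0.
apply: (@le_trans _ _ (\int[distribution P X]_x ((c `^ (1 - b) * K)%:E *
    (\int[distribution P Y]_y (D3 y)%:E * (D1 x)%:E)))).
  apply: ge0_le_integral => //.
  - by move=> x _; apply: integral_ge0 => y _; exact: integral_ge0.
  - by apply: emeasurable_funM => //; exact: emeasurable_funM.
  - move=> x _; apply: le_trans (inner2 x) _.
    by rewrite EFinM -muleA (muleC (D1 x)%:E).
rewrite ge0_integralZl//; last 3 first.
- exact: emeasurable_funM.
- move=> x _; rewrite mule_ge0 ?lee_fin// integral_ge0// => y _.
  by rewrite lee_fin.
- by rewrite lee_fin mulr_ge0 ?powR_ge0.
rewrite ge0_integralZl//; last 2 first.
- by move=> x _; rewrite lee_fin.
- by rewrite integral_ge0// => y _; rewrite lee_fin.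
by rewrite [X in _ * X]muleC.
Qed.

End Moments.

Section NullSets.
Context d (Omega : measurableType d) (R : realType) (P : probability Omega R).

(** Used to insert, before conditioning, the almost sure event on which the closed form of the mean
    holds. *)
Lemma le_probability_full (A F : set Omega) : measurable A -> measurable F ->
  P (~` F) = 0%E -> (P A <= P (F `&` A))%E.
Proof.
move=> mA mF F0; rewrite -[leRHS]adde0 -F0.
suff : (P A <= P ((F `&` A) `|` ~` F))%E.
  move/le_trans; apply.
  exact: measureU2 (measurableI _ _ mF mA) (measurableC mF).
apply: le_measure; rewrite ?inE//.
  by apply: measurableU; [exact: measurableI|exact: measurableC].
by move=> w Aw; have [Fw|Fw] := pselect (F w); [left|right].
Qed.

Lemma probability_setCI0 (A B : set Omega) : measurable A -> measurable B ->
  P (~` A) = 0%E -> P (~` B) = 0%E -> P (~` (A `&` B)) = 0%E.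
Proof.
move=> mA mB A0 B0; apply/eqP; rewrite eq_le measure_ge0 andbT setCI.
suff : (P (~` A) + P (~` B) <= 0)%E.
  by apply: le_trans; exact: measureU2 (measurableC mA) (measurableC mB).
by rewrite A0 B0 adde0.
Qed.

End NullSets.

(** * Tail of the older child of the root *)

Section Tails.
Context (d : measure_display) (Omega : measurableType d) (R : realType)
  (P : probability Omega R) (delta : R) (hdelta : -1 < delta)
  (T : ppt_data P) (hT : is_polya_point_tree delta T).

Let a := 1 + delta.
Let s := 2 + delta.
Let a0 : 0 < a. Proof. by move: hdelta => h; rewrite /a; lra. Qed.
Let s0 : 0 < s. Proof. by move: hdelta => h; rewrite /s; lra. Qed.

Lemma noise_indep3 (i j k : vertex + vertex) : uniq [:: i; j; k] ->
  forall A B C : set R, measurable A -> measurable B -> measurable C ->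
  P (noise T i @^-1` A `&` (noise T j @^-1` B `&` noise T k @^-1` C)) =
  (P (noise T i @^-1` A) * (P (noise T j @^-1` B) * P (noise T k @^-1` C)))%E.
Proof.
move=> uijk A B C mA mB mC.
pose D l : set R := if l == i then A else if l == j then B else C.
have mD l : measurable (D l) by rewrite /D; case: ifP => // _; case: ifP.
move: (uijk) => /=; rewrite !inE negb_or !andbT => /andP[/andP[ij ik] jk].
have Di : D i = A by rewrite /D eqxx.
have Dj : D j = B by rewrite /D eq_sym (negbTE ij) eqxx.
have Dk : D k = C by rewrite /D eq_sym (negbTE ik) eq_sym (negbTE jk).
have := ppt_indep hT uijk mD.
rewrite !big_cons big_nil mule1 Di Dj Dk => <-; congr (P _).
apply/seteqP; split => w /=.
  move=> [Aw [Bw Cw]] l; rewrite !inE => /or3P[] /eqP ->.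
  - by rewrite Di.
  - by rewrite Dj.
  - by rewrite Dk.
move=> h; split; last split.
- by rewrite -Di; apply: h; rewrite !inE eqxx.
- by rewrite -Dj; apply: h; rewrite !inE eqxx orbT.
- by rewrite -Dk; apply: h; rewrite !inE eqxx !orbT.
Qed.

Lemma ppt_U_full u : P (~` (ppt_U T u @^-1` `]0, 1])) = 0%E.
Proof.
rewrite probability_setC; last by apply: measurable_funPTI.
rewrite (uniform_law_itv (ppt_U_law hT u)) ?lexx ?ler01//.
by rewrite subr0 subee.
Qed.

Lemma ppt_Gamma_full u : P (~` (ppt_Gamma T u @^-1` `]0, +oo[)) = 0%E.
Proof.
rewrite preimage_setC setCitvr.
exact: (gamma_law_le0 (ppt_Gamma_law hT u)).
Qed.

Lemma ppt_U_moment u (b : R) : b < 1 ->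
  (\int[distribution P (ppt_U T u)]_x (x `^ (- b))%:E < +oo)%E.
Proof.
move=> b1; rewrite (integral_uniform_law (ppt_U_law hT u)); last 2 first.
- by apply/measurable_EFinP; exact: measurable_powR.
- by move=> x; rewrite lee_fin powR_ge0.
rewrite -integral_itv_obnd_cbnd; last exact: measurable_powR_EFin.
by apply: le_lt_trans (integral_powRN_near0 ltr01 b1) _; rewrite ltry.
Qed.

Let mU u : measurable_fun setT (ppt_U T u : Omega -> R).
Proof. exact: measurable_funP. Qed.
Let mGamma u : measurable_fun setT (ppt_Gamma T u : Omega -> R).
Proof. exact: measurable_funP. Qed.

(** The mean is at most G W^(-1/a) V^(-1/s). Raised to the power a it contains W with exponent -1,
    so (2M/y)^p is at most (t/W)^r with r = p/a and t = (2/y)^a G^a V^(-a/s): this is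
    [truncated_moment_le] with b = 0, and its bound is linear in t, hence of order y^(-a). *)
Lemma older_child_tail (p : nat) : 1 + delta < p%:R ->
  exists C : R, forall y : R, 0 < y -> 2 * p%:R <= y ->
  (P [set w | (y <= (size (ppt_younger T [:: 0%N] w))%:R)%R] <=
   (C * y `^ (- (1 + delta)))%:E)%E.
Proof.
move=> ap; pose r := p%:R / a.
have r1 : 1 < r by rewrite ltr_pdivlMr// mul1r.
pose V := ppt_U T [::]; pose W := ppt_U T [:: 0%N].
pose G := ppt_Gamma T [:: 0%N].
have mV : measurable_fun setT (V : Omega -> R) by exact: mU.
have mW : measurable_fun setT (W : Omega -> R) by exact: mU.
have mG : measurable_fun setT (G : Omega -> R) by exact: mGamma.
pose f2 g := g `^ a; pose f3 v := v `^ (- (a / s)).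
have K0 : (\int[distribution P G]_x (1 * f2 x `^ (1 - 0))%:E < +oo)%E.
  under eq_integral do rewrite subr0 mul1r powRr1 ?powR_ge0//.
  exact: (gamma_law_moment (ppt_Gamma_law hT _) (ltW a0)).
have K1 : (\int[distribution P V]_x (f3 x `^ (1 - 0))%:E < +oo)%E.
  under eq_integral do rewrite subr0 powRr1 ?powR_ge0//.
  apply: ppt_U_moment.
  by rewrite ltr_pdivrMr// mul1r /a /s ltrD2r ltr1n.
set M0 := (X in (X < _)%E) in K0; set M1 := (X in (X < _)%E) in K1.
have M00 : (0 <= M0)%E.
  by apply: integral_ge0 => x _; rewrite lee_fin mul1r powR_ge0.
have M10 : (0 <= M1)%E by apply: integral_ge0 => x _; rewrite lee_fin powR_ge0.
have fM0 : M0 \is a fin_num by rewrite ge0_fin_numE.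
have fM1 : M1 \is a fin_num by rewrite ge0_fin_numE.
exists (2 `^ a * ((1 - 0)^-1 + (0 + r - 1)^-1) * (fine M0 * fine M1)).
move=> y y0 py.
(* The trivial factors give [phi] the exact shape of the integrand in [truncated_moment_le]. *)
pose phi w := (1 * (W w `^ (- 0) *
  Num.min 1 (((2 / y) `^ a * f2 (G w) * f3 (V w)) `^ r * W w `^ (- r))))%R.
have c0 : 0 < (2 / y) `^ a by rewrite powR_gt0// divr_gt0.
have key : (\int[P]_w (phi w)%:E <= ((2 `^ a * ((1 - 0)^-1 + (0 + r - 1)^-1) *
    (fine M0 * fine M1)) * y `^ (- a))%:E)%E.
  have ind := @noise_indep3 (inr [:: 0%N]) (inl [::]) (inl [:: 0%N]) isT.
  have r0' : 0 < r by lra.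
  have r1' : 1 < 0 + r by lra.
  have mf1 : measurable_fun setT (fun _ : R => 1 : R) by exact: measurable_cst.
  have := @truncated_moment_le _ _ _ P G V W 0 r _ (fun=> 1) f2 f3
    ind (ppt_U_law hT _) (lexx 0) ltr01 r0' r1' c0 mf1 (measurable_powR a)
    (measurable_powR _) (fun=> ler01) (fun=> powR_ge0 _ _) (fun=> powR_ge0 _ _).
  move=> /le_trans; apply.
  rewrite -/M0 -/M1 -(fineK fM0) -(fineK fM1) -!EFinM lee_fin.
  have yE : y^-1 `^ a = y `^ (- a).
    by rewrite -powR_inv1 ?(ltW y0)// -powRrM mulN1r.
  rewrite subr0 (powRr1 (ltW c0)) powRM ?invr_ge0 ?(ltW y0)// yE.
  by rewrite le_eqVlt; apply/orP; left; apply/eqP; ring.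
apply: le_trans key.
pose F := V @^-1` `]0, 1] `&` (W @^-1` `]0, 1] `&` G @^-1` `]0, +oo[).
have FV : sigma_outside T [:: 0%N] F.
  pose OT := g_sigma_algebraType (outside_gens T [:: 0%N]).
  apply: (@measurableI _ OT); last apply: (@measurableI _ OT).
  - by apply: (@sigma_outside_preimage _ _ _ _ T _ (inl [::])).
  - by apply: (@sigma_outside_preimage _ _ _ _ T _ (inl [:: 0%N])).
  - by apply: (@sigma_outside_preimage _ _ _ _ T _ (inr [:: 0%N])).
have mF : measurable F by exact: (sigma_outside_measurable hT FV).
have F0 : P (~` F) = 0%E.
  apply: probability_setCI0;
    try by [exact: ppt_U_full|exact: measurable_funPTI].
    by apply: measurableI; exact: measurable_funPTI.
  apply: probability_setCI0;
    try by [exact: ppt_U_full|exact: measurable_funPTI].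
  exact: ppt_Gamma_full.
have ET : [set w | in_tree T [:: 0%N] w] = setT by apply/seteqP; split.
pose ag w := W w `^ (s / a) * V w.
pose m w := G w * Num.max 0 (ag w `^ (- (1 / s)) - 1).
have mm D : measurable_fun D m.
  apply: measurable_funTS; apply: measurable_funM => //.
  apply: measurable_maxr => //; apply: measurable_funB => //.
  apply: (measurableT_comp (measurable_powR _)).
  apply: measurable_funM => //.
  exact: (measurableT_comp (measurable_powR _)).
apply: le_trans (le_probability_full _ mF F0) _.
  exact: (measurable_size_preimage hT [:: 0%N] [set k | y <= k%:R]).
have := cond_poisson_size [set k | y <= k%:R]
  (@ppt_younger_poisson _ _ _ _ _ _ hT [:: 0%N]) FV _
  (ppt_younger_measurable hT _ measurableT) (mm _).
rewrite ET setIT => -> //; last first.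
  move=> w [/= Vw [Ww Gw]].
  move: Vw Ww Gw; rewrite !in_itv/= andbT => /andP[V0 V1] /andP[W0 W1] G0.
  by apply: mean_youngerE => //; [rewrite mulr_gt0// powR_gt0|exact: ltW].
have mphi : measurable_fun setT phi.
  apply: measurable_funM => //; apply: measurable_funM.
    exact: (measurableT_comp (measurable_powR _)).
  apply: measurable_minr => //; apply: measurable_funM.
    apply: (measurableT_comp (measurable_powR _)); apply: measurable_funM.
      apply: measurable_funM => //.
      exact: (measurableT_comp (measurable_powR _)).
    exact: (measurableT_comp (measurable_powR _)).
  exact: (measurableT_comp (measurable_powR _)).
have phi0 w : 0 <= phi w.
  by rewrite /phi mul1r mulr_ge0 ?powR_ge0// le_min ler01 mulr_ge0 ?powR_ge0.
apply: (@le_trans _ _ (\int[P]_(w in F) (phi w)%:E)%E); last first.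
  apply: ge0_subset_integral => //.
  - exact/measurable_EFinP.
  - by move=> w _; rewrite lee_fin.
apply: ge0_le_integral => //.
- exact: (measurableT_comp (measurable_poisson_prob_set _) (mm _)).
- by apply/measurable_EFinP; apply: measurable_funTS.
move=> w [/= Vw [Ww Gw]].
move: Vw Ww Gw; rewrite !in_itv/= andbT => /andP[V0 V1] /andP[W0 W1] G0.
have m0 : 0 <= m w by rewrite mulr_ge0 ?(ltW G0)// le_max lexx.
apply: le_trans (poisson_tail_le m0 y0 py) _.
rewrite lee_fin /phi mul1r oppr0 powRr0 mul1r le_min ge_min lexx/= ge_min.
apply/orP; right.
(* Upper bound for 2 m / y, obtained by dropping the -1 and the maximum in the mean. *)
pose z := 2 / y * (G w * (V w `^ (- (1 / s)) * W w `^ (- (1 / a)))).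
have z0 : 0 <= z by rewrite !mulr_ge0 ?powR_ge0 ?invr_ge0 ?(ltW y0) ?(ltW G0).
apply: (@le_trans _ _ (z ^+ p)).
  rewrite lerXn2r ?nnegrE//.
    by apply: divr_ge0; [apply: mulr_ge0|apply: ltW].
  rewrite /z mulrAC ler_wpM2l ?divr_ge0 ?(ltW y0)//.
  rewrite ler_wpM2l ?(ltW G0)// ge_max mulr_ge0 ?powR_ge0//=.
  rewrite lerBlDr /ag powRM ?powR_ge0 ?(ltW V0)// -powRrM.
  have -> : s / a * - (1 / s) = - (1 / a) by field; rewrite !gt_eqF.
  by rewrite mulrC lerDl.
rewrite -powR_mulrn// /f2 /f3.
have -> : z = ((2 / y) `^ a * G w `^ a * V w `^ (- (a / s))) `^ (1 / a) *
    W w `^ (- (1 / a)).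
  rewrite (@powRM _ ((2 / y) `^ a * G w `^ a)) ?mulr_ge0 ?powR_ge0//.
  rewrite (@powRM _ ((2 / y) `^ a)) ?powR_ge0// -!powRrM.
  have -> : a * (1 / a) = 1 by field; rewrite gt_eqF.
  have -> : - (a / s) * (1 / a) = - (1 / s) by field; rewrite !gt_eqF.
  rewrite !powRr1 ?(ltW G0) ?divr_ge0 ?(ltW y0)//.
  by rewrite /z !mulrA.
rewrite powRM ?powR_ge0// -!powRrM.
have -> : 1 / a * p%:R = r by rewrite mulrC mulrA mulr1.
by have -> : - (1 / a) * p%:R = - r by rewrite mulNr mulrC mulrA mulr1.
Qed.

End Tails.

(** * Tails of the younger children of the root, summed over these children *)

Section YoungerTails.
Context (d : measure_display) (Omega : measurableType d) (R : realType)
  (P : probability Omega R) (delta : R) (hdelta : -1 < delta)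
  (T : ppt_data P) (hT : is_polya_point_tree delta T).

Let a := 1 + delta.
Let s := 2 + delta.
Let a0 : 0 < a. Proof. by move: hdelta => h; rewrite /a; lra. Qed.
Let s0 : 0 < s. Proof. by move: hdelta => h; rewrite /s; lra. Qed.
Let s1 : 1 < s. Proof. by move: hdelta => h; rewrite /s; lra. Qed.

Let mU u : measurable_fun setT (ppt_U T u : Omega -> R).
Proof. exact: measurable_funP. Qed.
Let mGamma u : measurable_fun setT (ppt_Gamma T u : Omega -> R).
Proof. exact: measurable_funP. Qed.

Let rat_seq (n : nat) : R := ratr (odflt 0 (unpickle n : option rat)).

(* Up to countable unions, the event that some Younger child of the root is
   older than the root; the rational in between makes each piece visible to the
   Poisson counts. *)
Definition early_younger (n : nat) : set Omega :=
  [set w | `]rat_seq n, +oo[%classic (ppt_U T [::] w)] `&`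
  [set w | (0 < npoints (ppt_younger T [::]) `]-oo, rat_seq n[%classic w)%N].

Lemma early_younger_outside u n : u != [::] ->
  sigma_outside T u (early_younger n).
Proof.
move=> u0; pose OT := g_sigma_algebraType (outside_gens T u).
apply: (@measurableI _ OT).
  by apply: (@sigma_outside_preimage _ _ _ _ T _ (inl [::])).
have us : ~~ suffix u [::] by rewrite suffixs0.
have := @sigma_outside_npoints _ _ _ _ T u [::] _ us
  (measurable_itv `]-oo, rat_seq n[) measurableT [set k | (0 < k)%N].
by rewrite setTI; exact.
Qed.

(** If the age of the root exceeds q, the mean measure gives no mass to the points below q; a
    Poisson count of mean 0 is almost surely 0. *)
Lemma early_younger0 n : P (early_younger n) = 0%E.
Proof.
pose q := rat_seq n; pose B : set R := `]-oo, q[%classic.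
pose A := [set w | `]q, +oo[%classic (ppt_U T [::] w)].
have sA : sigma_outside T [::] A.
  by apply: (@sigma_outside_preimage _ _ _ _ T _ (inl [::])).
have mA : measurable A by exact: (sigma_outside_measurable hT sA).
have mB : measurable B by exact: measurable_itv.
have ET : [set w | in_tree T [::] w] = setT by apply/seteqP; split.
have mN := measurable_npoints_preimage hT [::] [set 0%N] mB.
have tI : trivIset setT (fun _ : 'I_1 => B) by move=> i j _ _ _; rewrite !ord1.
have := @ppt_younger_poisson _ _ _ _ _ _ hT [::] A 1%N (fun=> B) (fun=> 0%N)
  sA (fun=> mB) tI.
rewrite ET setIT.
have -> : [set w | 'I_1 -> npoints (ppt_younger T [::]) B w = 0%N] =
    [set w | [set 0%N] (npoints (ppt_younger T [::]) B w)].
  by apply/seteqP; split => w /=; [move=> /(_ ord0)|move=> h _].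
rewrite (eq_integral (fun=> 1%E)); last first.
  move=> w /[!inE] /= Aw; rewrite big_ord1 /mean_younger.
  have -> : B `&` `[age delta T [::] w, 1] = set0.
    apply/seteqP; split => // x [] /=; move: Aw.
    rewrite /A /= !in_itv/= ?andbT => qV xq /andP[Vx _].
    by move: (lt_trans xq qV); rewrite ltNge Vx.
  by rewrite Rintegral_set0 poisson_prob0// oppr0 expR0.
rewrite integral_cst// mul1e => PAN.
have -> : early_younger n =
    A `\` [set w | [set 0%N] (npoints (ppt_younger T [::]) B w)].
  rewrite /early_younger setDE; congr (_ `&` _); apply/seteqP; split => w /=.
    by rewrite lt0n => /eqP.
  by move=> h; rewrite lt0n; apply/eqP.
rewrite measureD//; last by rewrite ltey_eq fin_num_measure.
by rewrite [X in (_ - X)%E]PAN subee// fin_num_measure.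
Qed.

Lemma younger_age_ge w i : (forall n, ~ early_younger n w) ->
  (i < size (ppt_younger T [::] w))%N ->
  ppt_U T [::] w <= age delta T [:: i.+1] w.
Proof.
move=> ne isz; rewrite /age /= subn1 /=; set x := nth _ _ _.
rewrite leNgt; apply/negP => /rat_in_itvoo[q]; rewrite in_itv/= => /andP[xq qV].
apply: (ne (pickle q)); split; rewrite /= /rat_seq pickleK/=.
  by rewrite in_itv/= qV.
rewrite /npoints -has_count; apply/hasP; exists x; first exact: mem_nth.
by rewrite inE/= in_itv.
Qed.

(** Conditioning at child i turns its tail into [psi (G i w) (V w)], conditioning at the root turns
    its presence into a Poisson tail. After summation over i the latter becomes the mean number of
    younger children, at most G0 V^(-1/s). *)
Lemma younger_child_tail (p : nat) : 1 + delta < p%:R ->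
  exists C : R, forall y : R, 0 < y -> 2 * p%:R <= y ->
  (\sum_(i <oo) P ([set w | (i < size (ppt_younger T [::] w))%N] `&`
      [set w | (y <= (size (ppt_younger T [:: i.+1] w))%:R)%R]) <=
   (C * y `^ (- (1 + delta)))%:E)%E.
Proof.
(* The factor V^(-b) is the mean number of younger children, V^(-r) the p-th power in the tail of
   one of them; b + r > 1 reads 1 + p > s. The order is (y^(-s))^(1-b) = y^(-a). *)
move=> ap; pose r := p%:R / s; pose b := 1 / s.
have b0 : 0 <= b by rewrite divr_ge0// ltW.
have b1 : b < 1 by rewrite ltr_pdivrMr// mul1r.
have p0 : 0 < p%:R :> R by apply: lt_trans ap.
have r0 : 0 < r by rewrite divr_gt0.
have br : 1 < b + r.
  by rewrite -mulrDl ltr_pdivlMr// mul1r; move: ap; rewrite /s; lra.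
pose V := ppt_U T [::]; pose G0 := ppt_Gamma T [::].
pose G i := ppt_Gamma T [:: i.+1].
have mV : measurable_fun setT (V : Omega -> R) by exact: mU.
have mG0 : measurable_fun setT (G0 : Omega -> R) by exact: mGamma.
have mG i : measurable_fun setT (G i : Omega -> R) by exact: mGamma.
pose f1 (g : R) := g `^ 1; pose f3 (g : R) := g `^ s.
have sb : s * (1 - b) = a by rewrite /b /s /a; field; rewrite gt_eqF.
have K0 : (\int[distribution P G0]_x (f1 x * 1 `^ (1 - b))%:E < +oo)%E.
  under eq_integral do rewrite powR1 mulr1.
  exact: (gamma_law_moment (ppt_Gamma_law hT _) ler01).
have K1 : (\int[distribution P (G 0%N)]_x (f3 x `^ (1 - b))%:E < +oo)%E.
  under eq_integral do rewrite /f3 -powRrM sb.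
  exact: (gamma_law_moment (ppt_Gamma_law hT _) (ltW a0)).
set M0 := (X in (X < _)%E) in K0; set M1 := (X in (X < _)%E) in K1.
have M00 : (0 <= M0)%E.
  by apply: integral_ge0 => x _; rewrite lee_fin mulr_ge0 ?powR_ge0.
have M10 : (0 <= M1)%E by apply: integral_ge0 => x _; rewrite lee_fin powR_ge0.
have fM0 : M0 \is a fin_num by rewrite ge0_fin_numE.
have fM1 : M1 \is a fin_num by rewrite ge0_fin_numE.
exists (2 `^ a * ((1 - b)^-1 + (b + r - 1)^-1) * (fine M0 * fine M1)).
move=> y y0 py.
pose c := (2 / y) `^ s.
have c0 : 0 < c by rewrite powR_gt0// divr_gt0.
pose psi (g v : R) := Num.min 1 ((c * 1 * f3 g) `^ r * v `^ (- r)).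
have psi0 g v : 0 <= psi g v by rewrite le_min ler01 mulr_ge0 ?powR_ge0.
pose phi w := f1 (G0 w) * (V w `^ (- b) * psi (G 0%N w) (V w)).
have key : (\int[P]_w (phi w)%:E <= ((2 `^ a * ((1 - b)^-1 + (b + r - 1)^-1) *
    (fine M0 * fine M1)) * y `^ (- a))%:E)%E.
  have ind := @noise_indep3 _ _ _ _ _ _ hT
    (inr [::]) (inr [:: 1%N]) (inl [::]) isT.
  have mf2 : measurable_fun setT (fun _ : R => 1 : R) by exact: measurable_cst.
  have := @truncated_moment_le _ _ _ P G0 (G 0%N) V b r c f1 (fun=> 1) f3
    ind (ppt_U_law hT _) b0 b1 r0 br c0 (measurable_powR _) mf2
    (measurable_powR _) (fun=> powR_ge0 _ _) (fun=> ler01) (fun=> powR_ge0 _ _).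
  move=> /le_trans; apply.
  rewrite -/M0 -/M1 -(fineK fM0) -(fineK fM1) -!EFinM lee_fin.
  have yE : y^-1 `^ a = y `^ (- a).
    by rewrite -powR_inv1 ?(ltW y0)// -powRrM mulN1r.
  rewrite /c -powRrM sb powRM ?invr_ge0 ?(ltW y0)// yE.
  by rewrite le_eqVlt; apply/orP; left; apply/eqP; ring.
apply: le_trans key.
(* The values of the noise for which the mean at the root is given by [mu]. *)
pose Q : set (R * (R * R)) := `]0, +oo[%classic `*` (setT `*` `]0, 1]%classic).
have mQ : measurable Q.
  apply: measurableX; first exact: measurable_itv.
  by apply: measurableX => //; exact: measurable_itv.
pose mu (t : R * (R * R)) := t.1 * Num.max 0 (t.2.2 `^ (- (1 / s)) - 1).
have m22 : measurable_fun setT (fun t : R * (R * R) => t.2.2).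
  exact: (measurableT_comp measurable_snd measurable_snd).
have m21 : measurable_fun setT (fun t : R * (R * R) => t.2.1).
  exact: (measurableT_comp measurable_fst measurable_snd).
have mmu : measurable_fun setT mu.
  apply: measurable_funM => //; apply: measurable_maxr => //.
  apply: measurable_funB => //.
  exact: (measurableT_comp (measurable_powR _)).
pose psi' (t : R * (R * R)) := psi t.2.1 t.2.2.
have mpsi' : measurable_fun setT psi'.
  apply: measurable_minr => //; apply: measurable_funM; last first.
    exact: (measurableT_comp (measurable_powR _)).
  apply: (measurableT_comp (measurable_powR _)); apply: measurable_funM => //.
  exact: (measurableT_comp (measurable_powR _)).
(* On [Q], the conditional probability given the noise that the root has more than i younger
   children. *)
pose h i t := ((\1_Q t)%:E * poisson_prob (mu t) 0 [set k | (i < k)%N])%E.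
have mh i : measurable_fun setT (h i).
  apply: emeasurable_funM.
    by apply/measurable_EFinP; exact: measurable_indic.
  exact: (measurableT_comp (measurable_poisson_prob_set _)).
have h0 i t : (0 <= h i t)%E by rewrite mule_ge0 ?lee_fin.
have hfin i t : h i t \is a fin_num by rewrite fin_numM// fin_num_measure.
pose Phi i t := ((psi' t)%:E * h i t)%E.
have mPhi i : measurable_fun setT (Phi i).
  by apply: emeasurable_funM => //; exact/measurable_EFinP.
have psi'0 t : 0 <= psi' t by exact: psi0.
have Phi0 i t : (0 <= Phi i t)%E.
  by apply: mule_ge0; [rewrite lee_fin|exact: h0].
pose Y i w := (G0 w, (G i w, V w)).
have mY i : measurable_fun setT (Y i).
  apply: measurable_fun_pair; first exact: mG0.
  by apply: measurable_fun_pair; [exact: mG|exact: mV].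
have sY u i (B : set (R * (R * R))) : measurable B ->
    sigma_outside T u (Y i @^-1` B).
  move=> mB; pose OT := g_sigma_algebraType (outside_gens T u).
  have mYO : measurable_fun setT (Y i : OT -> R * (R * R)).
    apply: measurable_fun_pair; last apply: measurable_fun_pair.
    - exact: (@sigma_outside_noise _ _ _ _ T u (inr [::])).
    - exact: (@sigma_outside_noise _ _ _ _ T u (inr [:: i.+1])).
    - exact: (@sigma_outside_noise _ _ _ _ T u (inl [::])).
  by have := mYO measurableT _ mB; rewrite setTI.
pose E i := [set w | (i < size (ppt_younger T [::] w))%N].
have mE i : measurable (E i).
  exact: (measurable_size_preimage hT [::] [set k | (i < k)%N]).
have mYB i B : measurable B -> measurable (Y i @^-1` B).
  by move=> mB; rewrite -[_ @^-1` _]setTI; exact: mY.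
(* Conditioning at the child. Its being in the tree is the event [E i]: child i + 1 is entry i of
   the list, as index 0 belongs to the older child. *)
have step1 i : (P (E i `&`
      [set w | (y <= (size (ppt_younger T [:: i.+1] w))%:R)%R]) <=
    \int[P]_(w in Y i @^-1` Q `&` E i) (psi' (Y i w))%:E)%E.
  pose F1 := (G0 @^-1` `]0, +oo[) `&` (G i @^-1` `]0, +oo[ `&` V @^-1` `]0, 1]).
  pose F2 := ~` \bigcup_n early_younger n.
  have sF1 : sigma_outside T [:: i.+1] F1.
    have := @sY [:: i.+1] i (`]0, +oo[ `*` (`]0, +oo[ `*` `]0, 1])); apply.
    by apply: measurableX => //; exact: measurableX.
  have sF2 : sigma_outside T [:: i.+1] F2.
    pose OT := g_sigma_algebraType (outside_gens T [:: i.+1]).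
    apply: (@measurableC _ OT); apply: (@bigcupT_measurable _ OT) => n.
    exact: early_younger_outside.
  have sF : sigma_outside T [:: i.+1] (F1 `&` F2).
    exact: (@measurableI _ (g_sigma_algebraType (outside_gens T [:: i.+1]))).
  have mF1 := sigma_outside_measurable hT sF1.
  have mF2 := sigma_outside_measurable hT sF2.
  have mF := sigma_outside_measurable hT sF.
  have mearly n : measurable (early_younger n).
    apply: (sigma_outside_measurable hT).
    exact: (@early_younger_outside [:: i.+1] n isT).
  have F0 : P (~` (F1 `&` F2)) = 0%E.
    apply: probability_setCI0 => //; last first.
      rewrite setCK; apply: measure_negligible; first exact: bigcupT_measurable.
      apply: negligible_bigcup => n; apply/negligibleP => //.
      exact: early_younger0.
    apply: probability_setCI0.
    - exact: measurable_funPTI.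
    - by apply: measurableI; exact: measurable_funPTI.
    - exact: (ppt_Gamma_full hT).
    apply: probability_setCI0; try exact: measurable_funPTI.
      exact: (ppt_Gamma_full hT).
    exact: (ppt_U_full hT).
  pose S := [set w | y <= (size (ppt_younger T [:: i.+1] w))%:R].
  have mS : measurable S.
    exact: (measurable_size_preimage hT [:: i.+1] [set k | y <= k%:R]).
  have EE : [set w | in_tree T [:: i.+1] w] = E i by apply/seteqP; split.
  apply: (@le_trans _ _ (P (F1 `&` F2 `&` E i `&` S))).
    rewrite -(setIA (F1 `&` F2)); apply: le_probability_full => //.
    exact: measurableI.
  pose ag w := age delta T [:: i.+1] w.
  have mag : measurable_fun setT ag.
    apply: eq_measurable_fun (measurable_nth_younger hT [::] i) => w _.
    by rewrite /ag /= subn1.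
  pose m w := G i w * Num.max 0 (ag w `^ (- (1 / s)) - 1).
  have mm D : measurable_fun D m.
    apply: measurable_funTS; apply: measurable_funM => //.
    apply: measurable_maxr => //; apply: measurable_funB => //.
    exact: (measurableT_comp (measurable_powR _)).
  have inF w : (F1 `&` F2 `&` E i) w -> [/\ 0 < G0 w, 0 < G i w, 0 < V w,
      V w <= 1 & V w <= ag w].
    move=> [[[/= + [+ +]] nearly] Ew]; rewrite !in_itv/= !andbT.
    move=> g0 gi /andP[v0 v1]; split => //; apply: younger_age_ge => //.
    by move=> n en; apply: nearly; exists n.
  have mFE : measurable (F1 `&` F2 `&` E i) by exact: measurableI.
  apply: (@le_trans _ _ (\int[P]_(w in F1 `&` F2 `&` E i)
      poisson_prob (m w) 0 [set k : nat | (y <= k%:R)%R])%E).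
    have mFT : measurable (F1 `&` F2 `&` [set w | in_tree T [:: i.+1] w]).
      by rewrite EE.
    have cps := cond_poisson_size [set k | y <= k%:R]
      (@ppt_younger_poisson _ _ _ _ _ _ hT [:: i.+1]) sF mFT
      (ppt_younger_measurable hT _ measurableT) (mm _).
    have cps' := cps _; rewrite EE in cps'.
    rewrite cps'// => w /inF[_ gi v0 _ vag].
    by apply: mean_youngerE => //; [exact: lt_le_trans vag|exact: ltW].
  have mpsiY : measurable_fun setT (fun w => (psi' (Y i w))%:E).
    by apply/measurable_EFinP; exact: measurableT_comp.
  apply: (@le_trans _ _
      (\int[P]_(w in F1 `&` F2 `&` E i) (psi' (Y i w))%:E)%E); last first.
    apply: ge0_subset_integral => //.
    - by apply: measurableI => //; exact: mYB.
    - exact: measurable_funTS.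
    - by move=> w _; rewrite lee_fin; exact: psi'0.
    - by move=> w [[[g0 [gi v]] _] Ew]; split.
  apply: ge0_le_integral => //.
  - exact: (measurableT_comp (measurable_poisson_prob_set _) (mm _)).
  - exact: measurable_funTS.
  move=> w /inF[g0 gi v0 v1 vag].
  have m0 : 0 <= m w by rewrite mulr_ge0 ?(ltW gi)// le_max lexx.
  apply: le_trans (poisson_tail_le m0 y0 py) _.
  rewrite lee_fin /psi' /psi /= le_min ge_min lexx/= ge_min; apply/orP; right.
  (* Upper bound for 2 m / y: the age of the child is at least V, and the exponent -1/s is
     negative. *)
  pose z := 2 / y * (G i w * V w `^ (- (1 / s))).
  have z0 : 0 <= z by rewrite !mulr_ge0 ?powR_ge0 ?invr_ge0 ?(ltW y0) ?(ltW gi).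
  apply: (@le_trans _ _ (z ^+ p)).
    rewrite lerXn2r ?nnegrE//.
      by apply: divr_ge0; [apply: mulr_ge0|apply: ltW].
    rewrite /z mulrAC ler_wpM2l ?divr_ge0 ?(ltW y0)//.
    rewrite ler_wpM2l ?(ltW gi)// ge_max powR_ge0/=.
    rewrite lerBlDr powRN [V w `^ _]powRN.
    apply: (@le_trans _ _ (V w `^ (1 / s))^-1); last by rewrite lerDl.
    rewrite lef_pV2 ?posrE ?powR_gt0 ?(lt_le_trans v0)//.
    have vag0 : 0 <= ag w by exact: le_trans (ltW v0) vag.
    by apply: ge0_ler_powR; rewrite ?nnegrE ?(ltW v0)// divr_ge0 ?(ltW s0).
  rewrite -powR_mulrn// mulr1 /c /f3.
  have -> : z = ((2 / y) `^ s * G i w `^ s) `^ (1 / s) * V w `^ (- (1 / s)).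
    rewrite (@powRM _ ((2 / y) `^ s)) ?powR_ge0// -!powRrM.
    have -> : s * (1 / s) = 1 by field; rewrite gt_eqF.
    by rewrite !powRr1 ?(ltW gi) ?divr_ge0 ?(ltW y0)// /z mulrA.
  rewrite powRM ?powR_ge0// -!powRrM.
  have -> : 1 / s * p%:R = r by rewrite mulrC mulrA mulr1.
  by have -> : - (1 / s) * p%:R = - r by rewrite mulNr mulrC mulrA mulr1.
(* Conditioning at the root. This is possible with the child's Gamma variable in [Y i], since
   [sigma_outside] contains the noise of all vertices. *)
have step2 i : (\int[P]_(w in Y i @^-1` Q `&` E i) (psi' (Y i w))%:E =
    \int[P]_w Phi i (Y i w))%E.
  have ET : [set w | in_tree T [::] w] = setT by apply/seteqP; split.
  rewrite (@ge0_integral_density_in _ _ _ _ _ P (Y i @^-1` Q `&` E i) (Y i)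
    (fun w => h i (Y i w)) (fun t => (psi' t)%:E))//.
  - by apply: measurableI => //; exact: mYB.
  - exact: measurableT_comp.
  - move=> B mB; rewrite setIA -preimage_setI.
    have mBQ : measurable (B `&` Q) by exact: measurableI.
    transitivity (\int[P]_(w in Y i @^-1` (B `&` Q))
        poisson_prob (mu (Y i w)) 0 [set k | (i < k)%N])%E.
      have mm D : measurable_fun D (fun w => mu (Y i w)).
        exact: measurable_funTS (measurableT_comp mmu (mY i)).
      have mYBQ :
          measurable (Y i @^-1` (B `&` Q) `&` [set w | in_tree T [::] w]).
        by rewrite ET setIT; exact: mYB.
      have cps := cond_poisson_size [set k | (i < k)%N]
        (@ppt_younger_poisson _ _ _ _ _ _ hT [::]) (sY [::] i _ mBQ) mYBQ
        (ppt_younger_measurable hT _ measurableT) (mm _).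
      have := cps; rewrite ET setIT; apply.
      move=> w [_] /= [/=]; rewrite !in_itv/= !andbT => g0 [_ /andP[v0 v1]].
      by apply: mean_youngerE => //; exact: ltW.
    rewrite preimage_setI integral_mkcondr; apply: eq_integral => w _.
    rewrite patchE /h indicE.
    have -> : (w \in Y i @^-1` Q) = (Y i w \in Q).
      by apply/idP/idP; rewrite !inE.
    by case: ifPn => _; rewrite ?mul1e ?mul0e.
  - exact/measurable_EFinP.
have step3 i : (\int[P]_w Phi i (Y i w) = \int[P]_w Phi i (Y 0%N w))%E.
  have ind j : uniq [:: inr [::]; inr [:: j.+1]; inl [::] : vertex + vertex].
    by [].
  have tri j : (\int[P]_w Phi i (Y j w) = \int[distribution P G0]_x
      \int[distribution P (G j)]_g \int[distribution P V]_v
        Phi i (x, (g, v)))%E.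
    exact: (@ge0_integral_indep3 _ _ _ P _ _ _ _ _ _ G0 (G j) V (Phi i)
      (@noise_indep3 _ _ _ _ _ _ hT _ _ _ (ind j)) (mPhi i) (Phi0 i)).
  apply: etrans (tri i) _; apply: etrans _ (esym (tri 0%N)).
  apply: eq_integral => x _; apply: eq_measure_integral => A mA _.
  have law j : distribution P (G j) A = gamma_prob (1 + delta) A.
    exact: (ppt_Gamma_law hT [:: j.+1] mA).
  exact: etrans (law i) (esym (law 0%N)).
(* All G i have the same law, so that the sum over i only involves the tails of
   the number of Younger children of the root, which add up to its mean. *)
apply: (@le_trans _ _ (\sum_(i <oo) \int[P]_w Phi i (Y 0%N w)))%E.
  apply: lee_nneseries => // i _.
  have st := step1 i; rewrite (etrans (step2 i) (step3 i)) in st; exact st.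
have swap : (\int[P]_w (\sum_(i <oo) Phi i (Y 0%N w)) =
    \sum_(i <oo) \int[P]_w Phi i (Y 0%N w))%E.
  pose PhiY i w := Phi i (Y 0%N w).
  have mPhiY i : measurable_fun setT (PhiY i).
    exact: (measurableT_comp (mPhi i)).
  have PhiY0 i w : setT w -> (0 <= PhiY i w)%E by move=> _; exact: Phi0.
  exact: (@integral_nneseries _ _ _ P _ measurableT PhiY mPhiY PhiY0).
rewrite -swap.
have mphi : measurable_fun setT phi.
  apply: measurable_funM; first exact: (measurableT_comp (measurable_powR _)).
  apply: measurable_funM; first exact: (measurableT_comp (measurable_powR _)).
  exact: (measurableT_comp mpsi' (mY 0%N)).
apply: ge0_le_integral => //.
- by move=> w _; exact: nneseries_ge0.
- apply: ge0_emeasurable_sum => // i _.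
  exact: (measurableT_comp (mPhi i)).
- exact/measurable_EFinP.
move=> w _; rewrite /Phi /h.
under eq_eseriesr do rewrite muleA -EFinM.
rewrite nneseriesZl//.
rewrite indicE; have [|_] := boolP (Y 0%N w \in Q); last first.
  by rewrite mulr0 mul0e lee_fin !mulr_ge0 ?powR_ge0.
rewrite inE /= => -[/=]; rewrite !in_itv/= !andbT => g0 [_ /andP[v0 v1]].
rewrite mulr1.
have mu0 : 0 <= mu (Y 0%N w) by rewrite mulr_ge0 ?(ltW g0)// le_max lexx.
apply: le_trans (lee_wpmul2l _ (poisson_sum_tail_le mu0)) _.
  by rewrite lee_fin.
rewrite -EFinM lee_fin /phi mulrA mulrC ler_wpM2r//.
rewrite /f1 powRr1 ?(ltW g0)// /mu ler_wpM2l ?(ltW g0)//.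
by rewrite ge_max powR_ge0/= lerBlDr lerDl.
Qed.

End YoungerTails.

(** * Lower bound *)

Section LowerBound.
Context (d : measure_display) (Omega : measurableType d) (R : realType)
  (P : probability Omega R) (delta : R) (hdelta : -1 < delta)
  (T : ppt_data P) (hT : is_polya_point_tree delta T).

Let a := 1 + delta.
Let s := 2 + delta.
Let a0 : 0 < a. Proof. by move: hdelta => h; rewrite /a; lra. Qed.
Let s0 : 0 < s. Proof. by move: hdelta => h; rewrite /s; lra. Qed.

Let mU u : measurable_fun setT (ppt_U T u : Omega -> R).
Proof. exact: measurable_funP. Qed.
Let mGamma u : measurable_fun setT (ppt_Gamma T u : Omega -> R).
Proof. exact: measurable_funP. Qed.

(** Otherwise the half-line would be a countable union of null sets. This provides thresholds of
    positive probability without estimating the Gamma density. *)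
Lemma ppt_Gamma_mass u (A : nat -> set R) : (forall n, measurable (A n)) ->
  `]0, +oo[ `<=` \bigcup_n A n -> exists n, (0 < P (ppt_Gamma T u @^-1` A n))%E.
Proof.
move=> mA cov; apply/not_existsP => h.
have null n : P (ppt_Gamma T u @^-1` A n) = 0%E.
  by apply/eqP; rewrite eq_le measure_ge0 andbT leNgt; apply/negP.
have U0 : P (\bigcup_n (ppt_Gamma T u @^-1` A n)) = 0%E.
  apply: measure_negligible.
    by apply: bigcupT_measurable => n; exact: measurable_funPTI.
  apply: negligible_bigcup => n; apply/negligibleP; [|exact: null].
  exact: measurable_funPTI.
suff : (1%:E <= P (\bigcup_n (ppt_Gamma T u @^-1` A n)))%E.
  by rewrite U0 lee_fin ler10.
have mG : measurable (ppt_Gamma T u @^-1` `]0, +oo[).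
  exact: measurable_funPTI.
have G1 : P (ppt_Gamma T u @^-1` `]0, +oo[) = 1%E.
  rewrite -[ppt_Gamma T u @^-1` _]setCK probability_setC; last first.
    exact: measurableC.
  by rewrite (ppt_Gamma_full hT) sube0.
rewrite -G1; apply: le_measure; rewrite ?inE//.
  by apply: bigcupT_measurable => n; exact: measurable_funPTI.
by move=> w /= /cov [n _ An]; exists n.
Qed.

(** [F] constrains four independent noise variables, and only the constraint W <= t depends on y.
    Given [F], the root has no younger child with probability at least exp(-L). That event lies in
    [sigma_outside] of the older child, so conditioning there yields at least y younger children
    with probability at least 1/2. *)
Lemma leaf_root_tail : exists2 c : R, 0 < c & forall y : R, 1 <= y ->
  ((c * y `^ (- (1 + delta)))%:E <=
   P ([set w | size (ppt_younger T [::] w) = 0%N] `&`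
      [set w | (y <= (size (ppt_younger T [:: 0%N] w))%:R)%R]))%E.
Proof.
pose V := ppt_U T [::]; pose W := ppt_U T [:: 0%N].
pose G0 := ppt_Gamma T [::]; pose G1 := ppt_Gamma T [:: 0%N].
have [K PK] : exists n : nat, (0 < P (G0 @^-1` `]0%R, n%:R%R]))%E.
  apply: ppt_Gamma_mass => [n|x /=]; first exact: measurable_itv.
  rewrite in_itv/= andbT => x0; exists (Num.truncn x).+1 => //=.
  by rewrite in_itv/= x0 ltW// truncnS_gt.
have [n Peps] : exists n : nat, (0 < P (G1 @^-1` `[(n.+1%:R^-1)%R, +oo[))%E.
  apply: ppt_Gamma_mass => [n|x /=]; first exact: measurable_itv.
  rewrite in_itv/= andbT => x0; exists (Num.truncn x^-1) => //=.
  rewrite in_itv/= andbT -[leRHS]invrK lef_pV2 ?posrE ?invr_gt0//.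
  by rewrite ltW// truncnS_gt.
pose eps : R := n.+1%:R^-1.
have eps0 : 0 < eps by rewrite invr_gt0.
(* B is such that W <= (B * y)^(-a) and eps <= G1 give the older child a mean of
   at least 2 * (y + 1); L bounds the mean of the root. *)
pose B := 4 / eps + 1.
have B1 : 1 <= B by rewrite lerDr divr_ge0// ltW.
pose L := K%:R * (1 / 2) `^ (- (1 / s)) : R.
have fK : P (G0 @^-1` `]0, K%:R]) \is a fin_num.
  by apply: fin_num_measure; exact: measurable_funPTI.
have fe : P (G1 @^-1` `[eps, +oo[) \is a fin_num.
  by apply: fin_num_measure; exact: measurable_funPTI.
(* In order: the Poisson tail at the older child, the absence of younger children at the root, V >
   1/2, the two Gamma constraints, and the y-free part of t = (B y)^(-a). *)
exists (1 / 2 * (expR (- L) * (1 / 2 * (fine (P (G0 @^-1` `]0, K%:R])) *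
  (fine (P (G1 @^-1` `[eps, +oo[)) * B `^ (- a)))))).
  rewrite !mulr_gt0 ?expR_gt0 ?divr_gt0 ?powR_gt0//.
  - by rewrite fine_gt0// PK -ge0_fin_numE.
  - by rewrite fine_gt0// Peps -ge0_fin_numE.
  - exact: lt_le_trans B1.
move=> y y1; have y0 : 0 < y by exact: lt_le_trans y1.
pose t := (B * y) `^ (- a).
have By0 : 0 < B * y by rewrite mulr_gt0// (lt_le_trans _ B1).
have By1 : 1 <= B * y by rewrite -[leLHS]mulr1 ler_pM.
have t0 : 0 < t by exact: powR_gt0.
have t1 : t <= 1.
  by rewrite -[leRHS](powRr0 (B * y)) ler_powR// oppr_le0 ltW.
pose D (i : vertex + vertex) : set R := match i with
  | inl [::] => `](1 / 2), 1]%classic | inl _ => `]0, t]%classic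
  | inr [::] => `]0, K%:R]%classic | inr _ => `[eps, +oo[%classic end.
have mD i : measurable (D i) by case: i => -[|k u]; exact: measurable_itv.
pose ix : seq (vertex + vertex) :=
  [:: inl [::]; inr [::]; inr [:: 0%N]; inl [:: 0%N]].
pose F := [set w | forall i, i \in ix -> D i (noise T i w)].
have PF : P F = (1 / 2 * (fine (P (G0 @^-1` `]0, K%:R])) *
    (fine (P (G1 @^-1` `[eps, +oo[)) * t)))%:E.
  have uix : uniq ix by [].
  rewrite (ppt_indep hT uix mD) /ix !big_cons big_nil mule1 /=.
  rewrite (uniform_law_itv (ppt_U_law hT [::])); last 2 first.
  - by rewrite ler_pdivrMr// ler_pdivlMr//; lra.
  - by [].
  rewrite (uniform_law_itv (ppt_U_law hT [:: 0%N])) ?lexx ?(ltW t0)//.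
  rewrite subr0 -(fineK fK) -(fineK fe) -!EFinM.
  by congr (_ * _)%:E; lra.
have inF w : F w -> [/\ 1 / 2 < V w <= 1, 0 < G0 w <= K%:R, eps <= G1 w &
    0 < W w <= t].
  move=> Fw; have h i : i \in ix -> D i (noise T i w) by exact: Fw.
  split.
  - by have := h (inl [::]) isT; rewrite /= in_itv.
  - by have := h (inr [::]) isT; rewrite /= in_itv.
  - by have := h (inr [:: 0%N]) isT; rewrite /= in_itv/= andbT.
  - by have := h (inl [:: 0%N]) isT; rewrite /= in_itv.
have FE : F = V @^-1` `](1/2), 1] `&` (G0 @^-1` `]0, K%:R] `&`
    (G1 @^-1` `[eps, +oo[ `&` W @^-1` `]0, t])).
  apply/seteqP; split => w.
    by move=> /inF[v g0 g1 ww]; do !split => //=; rewrite in_itv//= andbT.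
  move=> [v [g0 [g1 ww]]] i; rewrite !inE => /or4P[] /eqP -> //.
have sF u : sigma_outside T u F.
  rewrite FE; pose OT := g_sigma_algebraType (outside_gens T u).
  apply: (@measurableI _ OT); last apply: (@measurableI _ OT);
    last apply: (@measurableI _ OT).
  - by apply: (@sigma_outside_preimage _ _ _ _ T _ (inl [::])).
  - by apply: (@sigma_outside_preimage _ _ _ _ T _ (inr [::])).
  - by apply: (@sigma_outside_preimage _ _ _ _ T _ (inr [:: 0%N])).
  - by apply: (@sigma_outside_preimage _ _ _ _ T _ (inl [:: 0%N])).
have mF : measurable F by exact: (sigma_outside_measurable hT (sF [::])).
have ET u : (forall w, in_tree T u w) -> [set w | in_tree T u w] = setT.
  by move=> h; apply/seteqP; split => w _ //=; exact: h.
pose N0 := [set w | size (ppt_younger T [::] w) = 0%N].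
have mN0 : measurable N0.
  exact: (measurable_size_preimage hT [::] [set 0%N]).
have sFN : sigma_outside T [:: 0%N] (F `&` N0).
  pose OT := g_sigma_algebraType (outside_gens T [:: 0%N]).
  apply: (@measurableI _ OT); first exact: sF.
  have ns : ~~ suffix [:: 0%N] [::] by [].
  have mN := @sigma_outside_npoints _ _ _ _ T [:: 0%N] [::] _ ns measurableT.
  have -> : N0 = npoints (ppt_younger T [::]) setT @^-1` [set 0%N].
    by apply/seteqP; split => w /=; rewrite npointsT.
  by rewrite -[_ @^-1` _]setTI; exact: mN.
have mFN : measurable (F `&` N0) by exact: measurableI.
have PFN : ((expR (- L))%:E * P F <= P (F `&` N0))%E.
  pose m w := G0 w * Num.max 0 (V w `^ (- (1 / s)) - 1).
  have mm D' : measurable_fun D' m.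
    apply: measurable_funTS; apply: measurable_funM; first exact: mGamma.
    apply: measurable_maxr => //; apply: measurable_funB => //.
    by apply: (measurableT_comp (measurable_powR _)); exact: mU.
  have mFT : measurable (F `&` [set w | in_tree T [::] w]).
    by rewrite ET// setIT.
  have cps := cond_poisson_size [set 0%N]
    (@ppt_younger_poisson _ _ _ _ _ _ hT [::]) (sF _) mFT
    (ppt_younger_measurable hT _ measurableT) (mm _).
  have := cps; rewrite ET// setIT => -> //; last first.
    move=> w /inF[/andP[v0 v1] /andP[g0 gK] _ _].
    apply: (mean_youngerE hdelta); last exact: ltW.
    by apply: lt_trans v0; rewrite divr_gt0.
  rewrite -integral_cst//; apply: ge0_le_integral => //.
  - by move=> w _; rewrite lee_fin expR_ge0.
  - exact: (measurableT_comp (measurable_poisson_prob_set _) (mm _)).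
  move=> w /inF[/andP[v0 v1] /andP[g0 gK] _ _].
  have m0 : 0 <= m w by rewrite mulr_ge0 ?(ltW g0)// le_max lexx.
  rewrite poisson_prob0// lee_fin ler_expR lerN2 /L.
  apply: ler_pM => //; first exact: ltW.
  rewrite ge_max powR_ge0/= lerBlDr.
  have v00 : 0 < V w by apply: lt_trans v0; rewrite divr_gt0.
  apply: (@le_trans _ _ ((1 / 2) `^ (- (1 / s)))); last by rewrite lerDl.
  rewrite !powRN lef_pV2 ?posrE ?powR_gt0 ?divr_gt0//.
  apply: ge0_ler_powR;
    by rewrite ?nnegrE ?divr_ge0 ?(ltW s0) ?(ltW v00) ?(ltW v0).
pose S := [set w | y <= (size (ppt_younger T [:: 0%N] w))%:R].
have mS : measurable S.
  exact: (measurable_size_preimage hT [:: 0%N] [set k | y <= k%:R]).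
apply: (@le_trans _ _ (P (F `&` N0 `&` S))); last first.
  apply: le_measure; rewrite ?inE; [exact: measurableI|exact: measurableI|].
  by move=> w [[_ ?] ?]; split.
have half : ((1 / 2)%:E * P (F `&` N0) <= P (F `&` N0 `&` S))%E.
  pose ag w := W w `^ (s / a) * V w.
  pose m w := G1 w * Num.max 0 (ag w `^ (- (1 / s)) - 1).
  have mm D' : measurable_fun D' m.
    apply: measurable_funTS; apply: measurable_funM; first exact: mGamma.
    apply: measurable_maxr => //; apply: measurable_funB => //.
    apply: (measurableT_comp (measurable_powR _)).
    apply: measurable_funM; last exact: mU.
    by apply: (measurableT_comp (measurable_powR _)); exact: mU.
  have ETw : [set w | in_tree T [:: 0%N] w] = setT by exact: ET.
  have mFT : measurable (F `&` N0 `&` [set w | in_tree T [:: 0%N] w]).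
    by rewrite ETw setIT.
  have cps := cond_poisson_size [set k | y <= k%:R]
    (@ppt_younger_poisson _ _ _ _ _ _ hT [:: 0%N]) sFN mFT
    (ppt_younger_measurable hT _ measurableT) (mm _).
  have := cps; rewrite ETw setIT => -> //; last first.
    move=> w [/inF[/andP[v0 v1] _ g1 /andP[w0 w1]] _].
    apply: mean_youngerE => //; last by apply: le_trans g1; exact: ltW.
    rewrite mulr_gt0 ?powR_gt0//.
    by apply: lt_trans v0; rewrite divr_gt0.
  rewrite -integral_cst//; apply: ge0_le_integral => //.
  - by move=> w _; rewrite lee_fin divr_ge0.
  - exact: (measurableT_comp (measurable_poisson_prob_set _) (mm _)).
  move=> w [/inF[/andP[v0 v1] _ g1 /andP[w0 w1]] _].
  have v00 : 0 < V w by apply: lt_trans v0; rewrite divr_gt0.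
  apply: poisson_tail_ge; first exact: ltW.
  have Wle : B * y <= W w `^ (- (1 / a)).
    have -> : B * y = t `^ (- (1 / a)).
      rewrite /t -powRrM.
      have -> : - a * - (1 / a) = 1 by field; rewrite gt_eqF.
      by rewrite powRr1// ltW.
    rewrite !powRN lef_pV2 ?posrE ?powR_gt0//.
    apply: ge0_ler_powR;
      by rewrite ?nnegrE ?divr_ge0 ?(ltW a0) ?(ltW w0) ?(ltW t0).
  have Vle : 1 <= V w `^ (- (1 / s)).
    rewrite powRN invf_ge1 ?powR_gt0// -[leRHS](powRr0 (V w)).
    by rewrite ger_powR ?v00// divr_ge0 ?(ltW s0).
  have agE : B * y <= ag w `^ (- (1 / s)).
    rewrite /ag powRM ?powR_ge0 ?(ltW v00)// -powRrM.
    have -> : s / a * - (1 / s) = - (1 / a) by field; rewrite !gt_eqF.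
    by rewrite -[leLHS]mulr1 ler_pM// ltW.
  (* By the choice of [B] this equals 4y + eps (y - 1), which is at least 2(y + 1) because y >=
     1. *)
  apply: (@le_trans _ _ (eps * (B * y - 1))).
    rewrite /B; have -> : eps * ((4 / eps + 1) * y - 1) = 4 * y + eps * (y - 1).
      by field; rewrite gt_eqF.
    by have : 0 <= eps * (y - 1); [rewrite mulr_ge0 ?subr_ge0 ?(ltW eps0)|lra].
  apply: ler_pM => //; first exact: ltW.
    by rewrite subr_ge0.
  by rewrite le_max lerB ?orbT.
apply: le_trans half; apply: le_trans (lee_wpmul2l _ PFN); last first.
  by rewrite lee_fin divr_ge0.
rewrite PF -!EFinM lee_fin /t powRM ?(ltW y0) ?(le_trans _ B1)//.
by rewrite le_eqVlt; apply/orP; left; apply/eqP; ring.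
Qed.

End LowerBound.

(** * Conclusion *)

Lemma asymp_pinfty_of_bounds (R : realType) (f g : R -> R) (c C x0 : R) :
  0 < c -> (forall x, x0 <= x -> 0 < g x) ->
  (forall x, x0 <= x -> c * g x <= f x <= C * g x) -> asymp_pinfty f g.
Proof.
move=> c0 g0 fg.
have V0 : +oo%R [set x : R | x0 <= x] by exact: nbhs_pinfty_ge (num_real _).
have bnd x : x0 <= x -> c <= f x / g x <= C.
  by move=> x0x; rewrite ler_pdivlMr ?g0// ler_pdivrMr ?g0// fg.
split; [apply/andP; split|].
- rewrite limf_einfE; apply: (@lt_le_trans _ _ c%:E); first by rewrite lte_fin.
  apply: le_trans (ereal_sup_ubound _); last by exists [set x | x0 <= x].
  apply: le_ereal_inf_tmp => _ [x /= x0x <-].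
  by rewrite lee_fin; case/andP: (bnd _ x0x).
- rewrite limf_einfE limf_esupE; apply: ge_ereal_sup => _ [V1 V1oo <-].
  apply: le_ereal_inf_tmp => _ [V2 V2oo <-].
  (* Two neighbourhoods of infinity share a point, whose value lies between the infimum over one and
     the supremum over the other. *)
  have [x [V1x V2x]] := filter_ex (filterI V1oo V2oo).
  apply: (@le_trans _ _ (f x / g x)%:E).
    by apply: ereal_inf_lbound; exists x.
  by apply: ereal_sup_ubound; exists x.
- rewrite limf_esupE; apply: (@le_lt_trans _ _ C%:E); last exact: ltry.
  apply: le_trans (ereal_inf_lbound _) _; first by exists [set x | x0 <= x].
  apply: ge_ereal_sup => _ [x /= x0x <-].
  by rewrite lee_fin; case/andP: (bnd _ x0x).
Qed.

(** * From the tails of single children to the bias *)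

Section FriendshipBias.
Context (d : measure_display) (Omega : measurableType d) (R : realType)
  (P : probability Omega R) (delta : R) (hdelta : -1 < delta)
  (T : ppt_data P) (hT : is_polya_point_tree delta T).

Lemma measurable_size_comp u (h : nat -> R) :
  measurable_fun setT (fun w => h (size (ppt_younger T u w))).
Proof.
move=> _ B mB; rewrite setTI.
exact: (measurable_size_preimage hT u (h @^-1` B)).
Qed.

Lemma measurable_friendship_bias_ge (x : R) :
  measurable [set w | x <= friendship_bias T w].
Proof.
pose g n w : R :=
  (\sum_(j < n) (nchildren T [:: nat_of_ord j] w + 1)%:R) / n%:R - n%:R.
have mg n : measurable_fun setT (g n).
  apply: measurable_funB => //; apply: measurable_funM => //.
  apply: measurable_sum => j.
  exact: (measurable_size_comp [:: nat_of_ord j]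
    (fun k => (has_older_child (label [:: nat_of_ord j]) + k + 1)%:R)).
(* Fixing the number of children of the root makes the length of the sum deterministic. *)
have -> : [set w | x <= friendship_bias T w] =
    \bigcup_n ([set w | nchildren T [::] w = n] `&` [set w | x <= g n w]).
  apply/seteqP; split => w /=.
    by move=> h; exists (nchildren T [::] w).
  by move=> [n _ [/= <-]].
apply: bigcupT_measurable => n; apply: measurableI.
  exact: (measurable_size_preimage hT [::] [set k | (1 + k)%N = n]).
have := mg n measurableT _ (measurable_itv `[x, +oo[); rewrite setTI.
by congr measurable; apply/seteqP; split => w /=; rewrite in_itv/= andbT.
Qed.

(** If every child has fewer than x/2 younger children, each term d_j + 1 is at most x/2 + 2 (the
    older child also has an older child). The bias is then at most x/2 + 2 - 1, which is below x as
    x > 2. *)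
Lemma friendship_bias_ge_sub (x : R) : 2 < x ->
  [set w | x <= friendship_bias T w] `<=`
  [set w | x / 2 <= (size (ppt_younger T [:: 0%N] w))%:R] `|`
  \bigcup_i ([set w | (i < size (ppt_younger T [::] w))%N] `&`
    [set w | x / 2 <= (size (ppt_younger T [:: i.+1] w))%:R]).
Proof.
move=> x2 w /= xD; apply: contrapT => /not_orP[/negP].
rewrite -ltNge => lt0 lti.
move: xD; apply/negP; rewrite -ltNge /friendship_bias.
set n := nchildren T [::] w; have n0 : 0 < n%:R :> R by rewrite ltr0n.
have n1 : 1 <= n%:R :> R by rewrite ler1n.
suff : \sum_(j < n) (nchildren T [:: nat_of_ord j] w + 1)%:R <=
    (x / 2 + 2) * n%:R.
  rewrite -ler_pdivrMr//; lra.
rewrite mulr_natr -[X in _ *+ X]card_ord -sumr_const.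
apply: ler_sum => -[[|j] jn] _.
  by rewrite /nchildren/= addnAC natrD; lra.
rewrite /nchildren/= add0n natrD.
have : (size (ppt_younger T [:: j.+1] w))%:R < x / 2.
  rewrite ltNge; apply/negP => h; apply: lti; exists j => //; split => //=.
lra.
Qed.

Lemma friendship_bias_tail_le : exists C x0 : R, forall x, x0 <= x ->
  tail_prob P (friendship_bias T) x <= C * x `^ (- (1 + delta)).
Proof.
pose p := (Num.truncn (1 + delta)).+1.
have ap : 1 + delta < p%:R by exact: truncnS_gt.
have [C1 tail1] := older_child_tail hdelta hT ap.
have [C2 tail2] := younger_child_tail hdelta hT ap.
(* The tails are taken at x/2, whence the power of 1/2; the threshold ensures x/2 >= 2p and x >
   2. *)
exists ((C1 + C2) * 2^-1 `^ (- (1 + delta))), (4 * p%:R + 3) => x xp.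
have p0 : 0 <= p%:R :> R by [].
have x2 : 2 < x by lra.
have y0 : 0 < x / 2 by lra.
have yp : 2 * p%:R <= x / 2 by lra.
rewrite -lee_fin /tail_prob fineK; last first.
  by apply: fin_num_measure; exact: measurable_friendship_bias_ge.
pose A := [set w | x / 2 <= (size (ppt_younger T [:: 0%N] w))%:R].
pose B i := [set w | (i < size (ppt_younger T [::] w))%N] `&`
    [set w | x / 2 <= (size (ppt_younger T [:: i.+1] w))%:R].
have mA : measurable A.
  exact: (measurable_size_preimage hT [:: 0%N] [set k | x / 2 <= k%:R]).
have mB i : measurable (B i).
  apply: measurableI.
    exact: (measurable_size_preimage hT [::] [set k | (i < k)%N]).
  exact: (measurable_size_preimage hT [:: i.+1] [set k | x / 2 <= k%:R]).
have mBU : measurable (\bigcup_i B i) by exact: bigcupT_measurable.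
apply: (@le_trans _ _ (P (A `|` \bigcup_i B i))).
  apply: le_measure; rewrite ?inE.
  - exact: measurable_friendship_bias_ge.
  - exact: measurableU.
  - exact: friendship_bias_ge_sub.
apply: (@le_trans _ _ (P A + P (\bigcup_i B i))%E); first exact: measureU2.
have -> : (C1 + C2) * 2^-1 `^ (- (1 + delta)) * x `^ (- (1 + delta)) =
    C1 * (x / 2) `^ (- (1 + delta)) + C2 * (x / 2) `^ (- (1 + delta)).
  by rewrite (mulrC x) powRM ?invr_ge0//; [ring|lra].
rewrite EFinD; apply: leeD; first exact: tail1.
apply: le_trans (tail2 _ y0 yp).
exact: generalized_Boole_inequality.
Qed.

Lemma nchildren_older_tail_le : exists C x0 : R, forall x, x0 <= x ->
  tail_prob P (fun w => (nchildren T [:: 0%N] w)%:R) x <=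
  C * x `^ (- (1 + delta)).
Proof.
pose p := (Num.truncn (1 + delta)).+1.
have ap : 1 + delta < p%:R by exact: truncnS_gt.
have [C1 tail1] := older_child_tail hdelta hT ap.
exists (C1 * 2^-1 `^ (- (1 + delta))), (4 * p%:R + 3) => x xp.
have p0 : 0 <= p%:R :> R by [].
have x2 : 2 < x by lra.
have y0 : 0 < x / 2 by lra.
have yp : 2 * p%:R <= x / 2 by lra.
have mD := measurable_size_preimage hT [:: 0%N] [set k | x <= (1 + k)%:R].
rewrite -lee_fin /tail_prob fineK; last exact: fin_num_measure.
have -> : C1 * 2^-1 `^ (- (1 + delta)) * x `^ (- (1 + delta)) =
    C1 * (x / 2) `^ (- (1 + delta)).
  by rewrite (mulrC x) powRM ?invr_ge0//; [ring|lra].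
apply: le_trans (tail1 _ y0 yp); apply: le_measure; rewrite ?inE//.
  exact: (measurable_size_preimage hT [:: 0%N] [set k | x / 2 <= k%:R]).
(* One of the [nchildren] is the older child; x - 1 >= x/2 since x > 2. *)
by move=> w /=; rewrite /nchildren/= add1n -natr1; lra.
Qed.

Lemma friendship_bias_tail_ge : exists2 c : R, 0 < c & forall x, 1 <= x ->
  c * x `^ (- (1 + delta)) <= tail_prob P (friendship_bias T) x /\
  c * x `^ (- (1 + delta)) <=
    tail_prob P (fun w => (nchildren T [:: 0%N] w)%:R) x.
Proof.
have [c c0 tail] := leaf_root_tail hdelta hT; exists c => // x x1.
have mL : measurable ([set w | size (ppt_younger T [::] w) = 0%N] `&`
      [set w | x <= (size (ppt_younger T [:: 0%N] w))%:R]).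
  apply: measurableI; first exact: (measurable_size_preimage hT [::] [set 0%N]).
  exact: (measurable_size_preimage hT [:: 0%N] [set k | x <= k%:R]).
have mD : measurable [set w | x <= (nchildren T [:: 0%N] w)%:R].
  exact: (measurable_size_preimage hT [:: 0%N] [set k | x <= (1 + k)%:R]).
have mF := measurable_friendship_bias_ge x.
split; rewrite -lee_fin /tail_prob fineK; try exact: fin_num_measure.
- apply: le_trans (tail _ x1) _; apply: le_measure; rewrite ?inE//.
  move=> w /= [leaf xs]; rewrite /friendship_bias.
  have -> : nchildren T [::] w = 1%N by rewrite /nchildren leaf.
  rewrite big_ord1 /nchildren/= divr1 natrD -[in X in X + _]natr1 add1n.
  by rewrite -natr1; lra.
- apply: le_trans (tail _ x1) _; apply: le_measure; rewrite ?inE//.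
  by move=> w /= [leaf xs]; rewrite /nchildren/= add1n -natr1; lra.
Qed.

End FriendshipBias.

Theorem theorem4p14 (d : measure_display) (Omega : measurableType d)
    (R : realType) (P : probability Omega R) (delta : R) (hdelta : -1 < delta)
    (T : ppt_data P) (hT : is_polya_point_tree delta T) :
  asymp_pinfty (tail_prob P (friendship_bias T))
               (tail_prob P (fun w => (nchildren T [:: 0%N] w)%:R)) /\
  asymp_pinfty (tail_prob P (friendship_bias T))
               (fun x => x `^ (- (tau delta - 2))).
Proof.
have [c c0 lower] := friendship_bias_tail_ge hdelta hT.
have [C [x1 upper]] := friendship_bias_tail_le hdelta hT.
have [C' [x2 upper']] := nchildren_older_tail_le hdelta hT.
pose x0 := Num.max 1 (Num.max x1 x2).
have x0P x : x0 <= x -> [/\ 1 <= x, x1 <= x & x2 <= x].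
  by rewrite !ge_max => /andP[? /andP[? ?]].
have pow0 x : x0 <= x -> 0 < x `^ (- (1 + delta)).
  by move=> /x0P[x_ge1 _ _]; apply: powR_gt0; exact: lt_le_trans x_ge1.
(* The upper constants come without a sign; at x0 the positive lower bound on the tail of d_1 forces
   this one to be positive. *)
have C'0 : 0 < C'.
  have [h1 _ h2] := x0P _ (lexx x0).
  rewrite -(pmulr_lgt0 _ (pow0 _ (lexx x0))).
  apply: lt_le_trans (upper' _ h2); apply: lt_le_trans (lower _ h1).2.
  by rewrite mulr_gt0// pow0.
split.
(* Both tails are compared through x^(-(1 + delta)), so the constants are quotients of those of the
   two bounds. *)
- apply: (@asymp_pinfty_of_bounds _ _ _ (c / C') (C / c) x0).
  + exact: divr_gt0.
  + move=> x x0x; have [h1 _ _] := x0P _ x0x.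
    by apply: lt_le_trans (lower _ h1).2; rewrite mulr_gt0// pow0.
  + move=> x x0x; have [h1 h2 h3] := x0P _ x0x.
    have [l1 l2] := lower _ h1; have u1 := upper _ h2; have u2 := upper' _ h3.
    have C0 : 0 <= C.
      rewrite -(pmulr_lge0 _ (pow0 _ x0x)); apply: le_trans u1.
      by apply: le_trans l1; rewrite mulr_ge0 ?(ltW c0) ?(ltW (pow0 _ x0x)).
    apply/andP; split.
      apply: le_trans l1; rewrite -mulrA ler_wpM2l ?(ltW c0)//.
      by rewrite mulrC ler_pdivrMr// mulrC.
    apply: le_trans u1 _; rewrite -mulrA ler_wpM2l//.
    by rewrite mulrC ler_pdivlMr// mulrC.
- have -> : tau delta - 2 = 1 + delta by rewrite /tau; lra.
  apply: (@asymp_pinfty_of_bounds _ _ _ c C x0) => // x x0x.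
  have [h1 h2 _] := x0P _ x0x.
  by rewrite (lower _ h1).1 upper.
Qed.
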